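(* Let $n \ge 2$ be an integer, let $\alpha \geq \max\{2(n-1),\, n+1\}$ be a real number, and let $f:\mathbb{R}\to\mathbb{R}$ be a smooth function with $$f(0)=0,\qquad f'(0)\neq 0,\qquad f(w)f'(w)\,w\ge 0 \ \text{ for all } w\in\mathbb{R},\qquad \int_0^\infty |f(v)|\,dv=\infty .$$ Let $T_0>0$ and let $u=u(t,r)$ be a smooth local solution of finite energy, on the cone $\Omega=\{(t,r): 0\le r\le t,\ 0<t\le T_0\}$, to $$u_{tt}-u_{rr}-\frac{n-1}{r}u_r+\frac{n-1}{2}\,\frac{\sin 2u}{r^2}+\frac{f(u)f'(u)}{r^\alpha}=0 .$$ Then $$\lim_{T\to 0^+}\int_{\Sigma_T}\left[\left(1-\frac rt\right)(u_t-u_r)^2+(u_t+u_r)^2+\frac{\sin^2u}{r^2}+\frac{f^2(u)}{r^\alpha}\right]=0 .$$ Moreover, $u$ is continuous at the origin: $$\lim_{\substack{(t,r)\to(0,0)\\ (t,r)\in\Omega}}u(t,r)=0 .$$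
   Context: A smooth local solution is a real-valued function $u$ that is smooth on $\Omega=\{(t,r): 0\le r\le t,\ 0<t\le T_0\}$ (including at $r=0$, $t>0$), satisfies the equation there for $r>0$, and satisfies the boundary condition $u(t,0)=0$ for all $0<t\le T_0$. (Data are prescribed at time $T_0$, and the possible singularity is at $(t,r)=(0,0)$; no regularity at $t=0$ is assumed.) For $0<T\le T_0$, $\Sigma_T=\{(T,r):0\le r\le T\}$. Since $r=|x|$ is the radial variable in $\mathbb{R}^n$, integrals over $\Sigma_T$ are taken with respect to $n$-dimensional Lebesgue measure: $\int_{\Sigma_T} g = A(\mathbb{S}^{n-1})\int_0^T g(T,r)\,r^{n-1}\,dr$, where $A(\mathbb{S}^{n-1})$ is the area of the unit sphere (and $t=T$ on $\Sigma_T$). The energy density is $e^+=\frac12(u_t^2+u_r^2)+\frac{n-1}{2}\frac{\sin^2u}{r^2}+\frac{f^2(u)}{2r^\alpha}$. Finite energy means that the local energy $E(t)=\int_{\Sigma_t}e^+$ is finite for every $0<t\le T_0$. *)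

(* Defs.v *)
From Stdlib Require Import Reals.
From Coquelicot Require Import Coquelicot.
Open Scope R_scope.

(* A(S^d), in hyperspherical coordinates:
   A(S^0) = 2 and A(S^(d+1)) = A(S^d) * int_0^PI (sin theta)^d dtheta. *)
Fixpoint sphere_area (d : nat) : R :=
  match d with
  | O => 2
  | S e => sphere_area e * RInt (fun theta => sin theta ^ e) 0 PI
  end.

Definition smooth (f : R -> R) : Prop :=
  forall (k : nat) (x : R), ex_derive_n f k x.

Definition Omega (T0 : R) (p : R * R) : Prop :=
  0 <= snd p <= fst p /\ 0 < fst p <= T0.

(* Smoothness on a set D that need not be open: C^infinity on an open
   neighbourhood of D.  A function given only on D is represented by any of its
   smooth extensions; its derivatives at the boundary points of D are those of
   the extension, which do not depend on the extension when D is contained in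
   the closure of its interior, as Omega is.  [ex_diff_n u k] is the C^k
   condition on two-variable functions. *)
Definition smooth_on (D : R * R -> Prop) (u : R -> R -> R) : Prop :=
  exists U : R * R -> Prop,
    open U /\ (forall p, D p -> U p) /\
    (forall p, U p -> forall k : nat, ex_diff_n u k (fst p) (snd p)).

Definition d_t (u : R -> R -> R) (t r : R) : R := Derive (fun s => u s r) t.
Definition d_r (u : R -> R -> R) (t r : R) : R := Derive (fun s => u t s) r.
Definition d_tt (u : R -> R -> R) : R -> R -> R := d_t (d_t u).
Definition d_rr (u : R -> R -> R) : R -> R -> R := d_r (d_r u).

Definition wave_equation_at (n : nat) (alpha : R) (f : R -> R)
    (u : R -> R -> R) (t r : R) : Prop :=
  d_tt u t r - d_rr u t r - (INR n - 1) / r * d_r u t r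
  + (INR n - 1) / 2 * (sin (2 * u t r) / r ^ 2)
  + f (u t r) * Derive f (u t r) / Rpower r alpha = 0.

Definition smooth_local_solution (n : nat) (alpha : R) (f : R -> R) (T0 : R)
    (u : R -> R -> R) : Prop :=
  smooth_on (Omega T0) u /\
  (forall t r, Omega T0 (t, r) -> 0 < r -> wave_equation_at n alpha f u t r) /\
  (forall t, 0 < t <= T0 -> u t 0 = 0).

(* Integration over Sigma_T for the n-dimensional Lebesgue measure.  The
   integrands below are nonnegative, continuous in 0 < r <= T and possibly
   unbounded as r -> 0+, so the radial integral is improper at 0; for them
   improper Riemann and Lebesgue integrals agree. *)
Definition radial (n : nat) (g : R -> R -> R) (T r : R) : R :=
  g T r * r ^ (n - 1).

Definition integrable_Sigma (n : nat) (g : R -> R -> R) (T : R) : Prop :=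
  ex_RInt_gen (radial n g T) (at_right 0) (at_point T).

Definition int_Sigma (n : nat) (g : R -> R -> R) (T : R) : R :=
  sphere_area (n - 1) * RInt_gen (radial n g T) (at_right 0) (at_point T).

Definition energy_density (n : nat) (alpha : R) (f : R -> R)
    (u : R -> R -> R) (t r : R) : R :=
  / 2 * (d_t u t r ^ 2 + d_r u t r ^ 2)
  + (INR n - 1) / 2 * (sin (u t r) ^ 2 / r ^ 2)
  + f (u t r) ^ 2 / (2 * Rpower r alpha).

Definition finite_energy (n : nat) (alpha : R) (f : R -> R) (T0 : R)
    (u : R -> R -> R) : Prop :=
  forall t, 0 < t <= T0 -> integrable_Sigma n (energy_density n alpha f u) t.

Definition decaying_density (alpha : R) (f : R -> R)
    (u : R -> R -> R) (t r : R) : R :=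
  (1 - r / t) * (d_t u t r - d_r u t r) ^ 2 + (d_t u t r + d_r u t r) ^ 2
  + sin (u t r) ^ 2 / r ^ 2 + f (u t r) ^ 2 / Rpower r alpha.

(* Main.v *)
Require Import Defs.
From Stdlib Require Import Reals Lra Lia List.
From Coquelicot Require Import Coquelicot.
Open Scope R_scope.

(** Write w = r^(n-1), m = (n-1)/2, X = f(u)^2 / r^alpha, Y = sin(u)^2 / r^2, and
    V = m Y + X/2, so that the energy density is e = (u_t^2 + u_r^2)/2 + V. Note
    that alpha >= n+1 >= 3.

    Height. Since x f(x) f'(x) >= 0, f^2 is monotone on each half-line; with
    f'(0) <> 0 this gives c > 0 with c |x| <= |f(x)| sqrt(1 + x^2) for all x
    ([growth_lower_bound]). Hence |d/dr sqrt(1 + u^2)| <= |f(u) u_r| / c. As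
    alpha >= 2(n-1), 1/w <= w / r^alpha for r <= 1, so by AM-GM, integrating
    from the axis, where u = 0,
      sqrt(1 + u^2) - 1 <= (lam * int u_r^2 w + (1/lam) * int X w) / (2c)
    for every lam > 0 ([height_from_energy]). With lam = 1 it shows that u is
    bounded by the energy, whence u^2 <= K f(u)^2 for some K ([height_bound]).
    Once the integral of X w tends to 0, it shows that u tends to 0 at the
    origin.

    Decay. The multiplier t u_t + r u_r + m u gives a conservation law up to a
    source term ([divergence_identity]). In the source, f f' u >= 0 and
    alpha >= n+1 make the f-terms nonnegative, and the trigonometric terms are
    at most a multiple of u^2/r^2 <= K f(u)^2/r^2 <= K r X, which is smaller
    than the energy density by a factor r. On the lateral boundary r = t of the
    cone the flux of this law is bounded by t times the flux of the energy.
    Integrating between the slices S and T thus gives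
      int_(Sigma_T) w (T e + r u_t u_r + m u u_t)
        <= C (S E + T (E(T) - E(S)) + T^2 E).
    The left side is at least T/4 times the integral in the theorem minus
    C T sqrt(T) E, since
      4 (T e + r u_t u_r)
        = (T - r)(u_t - u_r)^2 + (T + r)(u_t + u_r)^2 + 4 T V,
    and u u_t is small because u^2 <= K r^3 X. As E is nonincreasing when T
    decreases to 0, it has a limit there; dividing by T and taking S a small
    multiple of T gives the decay ([morawetz_estimate]).

    Rigour at the axis. The coordinates (t, s) with r = t s turn the cone into
    a strip, so that differentiating an integral over eps <= s <= 1 in t moves
    no endpoint. The flux through s = eps vanishes as eps -> 0: the equation at
    small r bounds f(u) f'(u) by a multiple of r^(alpha-1), hence f(u) too
    ([bounds_near_axis]). *)

(** * Two-variable calculus *)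

Lemma continuity_2d_continuous (g : R -> R -> R) (x y : R) :
  continuity_2d_pt g x y -> continuous (fun p : R * R => g (fst p) (snd p)) (x, y).
Proof. intros H. apply continuity_2d_pt_filterlim, H. Qed.

Lemma differentiable_of_C1 (g : R -> R -> R) (x y : R) :
  locally_2d (fun x' y' => ex_diff_n g 1 x' y') x y ->
  differentiable_pt_lim g x y (d_t g x y) (d_r g x y).
Proof.
  intros H. apply filterdiff_differentiable_pt_lim.
  apply filterdiff_ext_lin with
    (fun p : R * R => plus (scal (fst p) (d_t g x y)) (scal (snd p) (d_r g x y))).
  2: { intros p. reflexivity. }
  pose proof (locally_2d_singleton _ _ _ H) as [_ [_ [Hy [[Hc _] _]]]].
  apply is_derive_filterdiff.
  - apply locally_2d_locally in H. revert H. apply filter_imp.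
    intros p [_ [Hx _]]. apply Derive_correct, Hx.
  - apply Derive_correct, Hy.
  - apply (continuity_2d_continuous (d_t g)), Hc.
Qed.

(** What the proof uses of smoothness. The mixed derivative appears only as
    [d_r (d_t u)]: Schwarz's theorem has been used once and for all in the
    derivatives of [d_r u]. *)
Record C2_field (U : R * R -> Prop) (u : R -> R -> R) : Prop := {
  C2_open : forall t r, U (t, r) -> locally_2d (fun t' r' => U (t', r')) t r;
  C2_u : forall t r, U (t, r) ->
    differentiable_pt_lim u t r (d_t u t r) (d_r u t r);
  C2_ut : forall t r, U (t, r) ->
    differentiable_pt_lim (d_t u) t r (d_tt u t r) (d_r (d_t u) t r);
  C2_ur : forall t r, U (t, r) ->
    differentiable_pt_lim (d_r u) t r (d_r (d_t u) t r) (d_rr u t r);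
  C2_utt : forall t r, U (t, r) -> continuity_2d_pt (d_tt u) t r;
  C2_urt : forall t r, U (t, r) -> continuity_2d_pt (d_r (d_t u)) t r;
  C2_urr : forall t r, U (t, r) -> continuity_2d_pt (d_rr u) t r }.

Arguments C2_open {U u} _ {t r} _.
Arguments C2_u {U u} _ {t r} _.
Arguments C2_ut {U u} _ {t r} _.
Arguments C2_ur {U u} _ {t r} _.
Arguments C2_utt {U u} _ {t r} _.
Arguments C2_urt {U u} _ {t r} _.
Arguments C2_urr {U u} _ {t r} _.

Lemma C2_field_of_ex_diff_n (U : R * R -> Prop) (u : R -> R -> R) :
  open U -> (forall p, U p -> forall k : nat, ex_diff_n u k (fst p) (snd p)) ->
  C2_field U u.
Proof.
  intros HU Hs.
  assert (Hop : forall t r, U (t, r) -> locally_2d (fun t' r' => U (t', r')) t r).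
  { intros t r H. apply locally_2d_locally. specialize (HU _ H). revert HU.
    apply filter_imp. intros [a b]. auto. }
  assert (Hl : forall (P : R -> R -> Prop), (forall t r, U (t, r) -> P t r) ->
             forall t r, U (t, r) -> locally_2d P t r).
  { intros P HP t r H. generalize (Hop t r H). apply locally_2d_impl.
    apply locally_2d_forall. auto. }
  assert (H2 : forall t r, U (t, r) -> ex_diff_n u 2 t r).
  { intros t r H. apply (Hs _ H 2%nat). }
  assert (Hmix : forall t r, U (t, r) -> d_t (d_r u) t r = d_r (d_t u) t r).
  { intros t r H. apply (Schwarz u t r).
    - apply Hl; [|exact H]. intros t' r' H'.
      destruct (H2 _ _ H') as (_ & Ht & Hr & (_ & _ & Htr & _) & (_ & Hrt & _)).
      exact (conj Ht (conj Hr (conj Hrt Htr))).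
    - apply (H2 _ _ H).
    - apply (H2 _ _ H). }
  assert (Hmixc : forall t r, U (t, r) -> continuity_2d_pt (d_r (d_t u)) t r).
  { intros t r H. apply (H2 _ _ H). }
  split; auto.
  - intros t r H. apply differentiable_of_C1, Hl; [|exact H].
    intros t' r' H'. apply (Hs _ H' 1%nat).
  - intros t r H. apply differentiable_of_C1, Hl; [|exact H].
    intros t' r' H'. apply (H2 _ _ H').
  - intros t r H. rewrite <- (Hmix t r H). apply differentiable_of_C1, Hl; [|exact H].
    intros t' r' H'. apply (H2 _ _ H').
  - intros t r H. apply (H2 _ _ H).
  - intros t r H. apply (H2 _ _ H).
Qed.

Lemma is_derive_comp_2d (g : R -> R -> R) (c1 c2 : R -> R) (x g1 g2 d1 d2 : R) :
  differentiable_pt_lim g (c1 x) (c2 x) g1 g2 ->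
  is_derive c1 x d1 -> is_derive c2 x d2 ->
  is_derive (fun y => g (c1 y) (c2 y)) x (g1 * d1 + g2 * d2).
Proof.
  intros Hg H1 H2. apply is_derive_Reals.
  apply derivable_pt_lim_comp_2d; [exact Hg | |]; apply is_derive_Reals; assumption.
Qed.

Lemma differentiable_lim_continuity (g : R -> R -> R) (x y g1 g2 : R) :
  differentiable_pt_lim g x y g1 g2 -> continuity_2d_pt g x y.
Proof. intros H. apply differentiable_continuity_pt. exists g1, g2. exact H. Qed.

Lemma continuity_2d_comp (g h1 h2 : R -> R -> R) (x y : R) :
  continuity_2d_pt g (h1 x y) (h2 x y) ->
  continuity_2d_pt h1 x y -> continuity_2d_pt h2 x y ->
  continuity_2d_pt (fun x' y' => g (h1 x' y') (h2 x' y')) x y.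
Proof.
  intros Hg H1 H2 e. destruct (Hg e) as [d Hd].
  generalize (locally_2d_and _ _ _ _ (H1 d) (H2 d)). apply locally_2d_impl.
  apply locally_2d_forall. intros x' y' [A B]. apply Hd; assumption.
Qed.

Lemma continuity_2d_section (g : R -> R -> R) (x y : R) :
  continuity_2d_pt g x y -> continuous (g x) y.
Proof.
  intros H. apply continuity_pt_filterlim. intros e He.
  destruct (H (mkposreal e He)) as [d Hd]. exists d. split; [apply cond_pos|].
  intros z [_ Hz]. apply (Hd x z); [|exact Hz].
  rewrite Rminus_diag, Rabs_R0. apply cond_pos.
Qed.

(** The divergence theorem in one strip: if p_t = J_s - q, the integral of p over
    a fixed interval in s changes by the boundary values of J and by the source. *)
Lemma is_derive_RInt_divergence (a b t : R) (p dp J q : R -> R -> R) :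
  a <= b ->
  locally t (fun t' => forall s, a <= s <= b ->
    continuity_2d_pt p t' s /\
    locally_2d (fun t'' s' => is_derive (fun z => p z s') t'' (dp t'' s')) t' s) ->
  (forall s, a <= s <= b -> continuity_2d_pt dp t s) ->
  (forall s, a <= s <= b -> is_derive (J t) s (dp t s + q t s)) ->
  (forall s, a <= s <= b -> continuous (q t) s) ->
  is_derive (fun t' => RInt (p t') a b) t (J t b - J t a - RInt (q t) a b).
Proof.
  intros Hab Hp Hdp HJ Hq.
  pose proof (locally_singleton _ _ Hp) as Hp0.
  assert (Hdpc : forall s, a <= s <= b -> continuous (dp t) s).
  { intros s Hs. apply continuity_2d_section, Hdp, Hs. }
  replace (J t b - J t a - RInt (q t) a b)
    with (RInt (fun s => Derive (fun t' => p t' s) t) a b).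
  - apply is_derive_RInt_param.
    + revert Hp. apply filter_imp. intros t' H s Hs.
      rewrite Rmin_left, Rmax_right in Hs by exact Hab.
      destruct (H s Hs) as [_ D]. apply locally_2d_singleton in D.
      exists (dp t' s). exact D.
    + intros s Hs. rewrite Rmin_left, Rmax_right in Hs by exact Hab.
      apply continuity_2d_pt_ext_loc with dp; [|apply Hdp, Hs].
      generalize (proj2 (Hp0 s Hs)). apply locally_2d_impl, locally_2d_forall.
      intros t' s' D. symmetry. apply is_derive_unique, D.
    + revert Hp. apply filter_imp. intros t' H. apply (ex_RInt_continuous (V := R_CompleteNormedModule)).
      intros s Hs. rewrite Rmin_left, Rmax_right in Hs by exact Hab.
      apply continuity_2d_section, H, Hs.
  - rewrite (RInt_ext _ (dp t)).
    2: { intros s Hs. rewrite Rmin_left, Rmax_right in Hs by exact Hab.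
         apply is_derive_unique. apply (locally_2d_singleton _ _ _ (proj2 (Hp0 s ltac:(lra)))). }
    assert (HI : is_RInt (fun s => dp t s + q t s) a b (J t b - J t a)).
    { apply (is_RInt_derive (V := R_CompleteNormedModule) (J t)).
      - intros s Hs. rewrite Rmin_left, Rmax_right in Hs by exact Hab. apply HJ, Hs.
      - intros s Hs. rewrite Rmin_left, Rmax_right in Hs by exact Hab.
        apply (continuous_plus (dp t) (q t)); auto. }
    apply (is_RInt_unique (V := R_CompleteNormedModule)) in HI.
    rewrite <- HI, <- (Rplus_minus_r (RInt (dp t) a b) (RInt (q t) a b)) at 1.
    f_equal. symmetry. apply (RInt_plus (V := R_CompleteNormedModule) (dp t) (q t)).
    + apply (ex_RInt_continuous (V := R_CompleteNormedModule)).
      intros s Hs. rewrite Rmin_left, Rmax_right in Hs by exact Hab. auto.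
    + apply (ex_RInt_continuous (V := R_CompleteNormedModule)).
      intros s Hs. rewrite Rmin_left, Rmax_right in Hs by exact Hab. auto.
Qed.


(** * The multiplier identity *)

(** The part V of the energy density that does not involve derivatives. Here and
    below v, a, b stand for the values of u, u_t, u_r. *)
Definition potential_density (n : nat) (alpha : R) (f : R -> R) (r v : R) : R :=
  (INR n - 1) / 2 * (sin v ^ 2 / r ^ 2) + f v ^ 2 / (2 * Rpower r alpha).

Definition potential_density_diff (n : nat) (alpha : R) (f : R -> R) (r v r' v' : R) : R :=
  (INR n - 1) / 2 * (2 * sin v * cos v * v' / r ^ 2 - 2 * sin v ^ 2 * r' / r ^ 3)
  + (2 * f v * Derive f v * v' - alpha * f v ^ 2 * r' / r) / (2 * Rpower r alpha).

(** Density, flux and source of the law P_t = R_r - Q obtained from the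
    multiplier (A t + B) u_t + A (r u_r + m u). The pair (A, B) = (0, 1) gives
    conservation of energy; A = 1 with a constant B gives the scaling identity
    corrected by a multiple of the energy. *)
Definition mul_density (n : nat) (alpha : R) (f : R -> R) (A B t r v a b : R) : R :=
  r ^ (n - 1) * ((A * t + B) * (/ 2 * (a ^ 2 + b ^ 2) + potential_density n alpha f r v)
    + A * (r * a * b + (INR n - 1) / 2 * v * a)).

Definition mul_flux (n : nat) (alpha : R) (f : R -> R) (A B t r v a b : R) : R :=
  r ^ (n - 1) * ((A * t + B) * (a * b)
    + A * (r * (/ 2 * (a ^ 2 + b ^ 2) - potential_density n alpha f r v) + (INR n - 1) / 2 * v * b)).

Definition mul_source (n : nat) (alpha : R) (f : R -> R) (A r v : R) : R :=
  r ^ (n - 1) * (A * (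
    (INR n - 1) / 2 * ((INR n - 1) / 2 * (v * sin (2 * v) / r ^ 2)
                       + f v * Derive f v * v / Rpower r alpha)
    - (INR n - 1) ^ 2 / 2 * (sin v ^ 2 / r ^ 2)
    + (alpha - INR n - 1) * (f v ^ 2 / (2 * Rpower r alpha)))).

(** The derivative of [mul_density] along a curve on which (t, r, v, a, b) moves
    with velocity (t', r', v', a', b'); likewise for the other two differentials. *)
Definition mul_density_diff (n : nat) (alpha : R) (f : R -> R)
    (A B t r v a b t' r' v' a' b' : R) : R :=
  (INR n - 1) / r * r' * mul_density n alpha f A B t r v a b
  + r ^ (n - 1) * (A * t' * (/ 2 * (a ^ 2 + b ^ 2) + potential_density n alpha f r v)
    + (A * t + B) * (a * a' + b * b' + potential_density_diff n alpha f r v r' v')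
    + A * (r' * a * b + r * a' * b + r * a * b' + (INR n - 1) / 2 * (v' * a + v * a'))).

Definition mul_flux_diff (n : nat) (alpha : R) (f : R -> R)
    (A B t r v a b t' r' v' a' b' : R) : R :=
  (INR n - 1) / r * r' * mul_flux n alpha f A B t r v a b
  + r ^ (n - 1) * (A * t' * (a * b) + (A * t + B) * (a' * b + a * b')
    + A * (r' * (/ 2 * (a ^ 2 + b ^ 2) - potential_density n alpha f r v)
           + r * (a * a' + b * b' - potential_density_diff n alpha f r v r' v')
           + (INR n - 1) / 2 * (v' * b + v * b'))).

Lemma INR_pred (n : nat) : (2 <= n)%nat -> INR (n - 1) = INR n - 1.
Proof. intros H. rewrite minus_INR by lia. reflexivity. Qed.

Lemma Derive_eta (g : R -> R) (x l : R) :
  is_derive g x l -> Derive (fun y : R => g y) x = l.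
Proof. apply is_derive_unique. Qed.

Lemma is_derive_weight (n : nat) (r : R -> R) (x r' : R) :
  (2 <= n)%nat -> r x <> 0 -> is_derive r x r' ->
  is_derive (fun y => r y ^ (n - 1)) x ((INR n - 1) / r x * r' * r x ^ (n - 1)).
Proof.
  intros Hn H0 Hr. rewrite <- INR_pred by exact Hn.
  destruct (n - 1)%nat as [|k] eqn:Hk; [lia|].
  evar_last. { apply is_derive_pow, Hr. }
  simpl pred. rewrite <- tech_pow_Rmult. field. exact H0.
Qed.

Lemma is_derive_potential_density (n : nat) (alpha : R) (f : R -> R) (r v : R -> R) (x r' v' : R) :
  0 < r x -> ex_derive f (v x) -> is_derive r x r' -> is_derive v x v' ->
  is_derive (fun y => potential_density n alpha f (r y) (v y)) x
    (potential_density_diff n alpha f (r x) (v x) r' v').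
Proof.
  intros H0 Hf Hr Hv. pose proof (exp_pos (alpha * ln (r x))) as He.
  unfold potential_density, potential_density_diff, Rpower.
  auto_derive.
  - repeat split; auto; try lra; try (eexists; eassumption).
    + apply Rgt_not_eq. change (0 < r x * (r x * 1)). nra.
  - rewrite (Derive_eta _ _ _ Hr), (Derive_eta _ _ _ Hv).
    change (Derive (fun x0 => f x0) (v x)) with (Derive f (v x)).
    field. lra.
Qed.

Lemma is_derive_mul_density n alpha f A B (t r v a b : R -> R) (x t' r' v' a' b' : R) :
  (2 <= n)%nat -> 0 < r x -> ex_derive f (v x) ->
  is_derive t x t' -> is_derive r x r' -> is_derive v x v' ->
  is_derive a x a' -> is_derive b x b' ->
  is_derive (fun y => mul_density n alpha f A B (t y) (r y) (v y) (a y) (b y)) x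
    (mul_density_diff n alpha f A B (t x) (r x) (v x) (a x) (b x) t' r' v' a' b').
Proof.
  intros Hn H0 Hf Ht Hr Hv Ha Hb.
  pose proof (is_derive_weight n r x r' Hn ltac:(lra) Hr) as Hw.
  pose proof (is_derive_potential_density n alpha f r v x r' v' H0 Hf Hr Hv) as Hp.
  unfold mul_density_diff, mul_density.
  pose (w := fun y : R => r y ^ (n - 1)).
  pose (p := fun y : R => potential_density n alpha f (r y) (v y)).
  change (is_derive w x ((INR n - 1) / r x * r' * r x ^ (n - 1))) in Hw.
  change (is_derive p x (potential_density_diff n alpha f (r x) (v x) r' v')) in Hp.
  apply (is_derive_ext (fun y => w y * ((A * t y + B) * (/ 2 * (a y ^ 2 + b y ^ 2) + p y)
    + A * (r y * a y * b y + (INR n - 1) / 2 * v y * a y)))); [reflexivity|].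
  assert (Hwx : r x ^ (n - 1) = w x) by reflexivity.
  assert (Hpx : potential_density n alpha f (r x) (v x) = p x) by reflexivity.
  rewrite Hwx in *. rewrite Hpx. clearbody w p.
  auto_derive.
  - repeat split; eexists; eassumption.
  - rewrite (Derive_eta _ _ _ Hr), (Derive_eta _ _ _ Hv),
      (Derive_eta _ _ _ Ht), (Derive_eta _ _ _ Ha),
      (Derive_eta _ _ _ Hb), (Derive_eta _ _ _ Hw), (Derive_eta _ _ _ Hp).
    field. lra.
Qed.

Lemma is_derive_mul_flux n alpha f A B (t r v a b : R -> R) (x t' r' v' a' b' : R) :
  (2 <= n)%nat -> 0 < r x -> ex_derive f (v x) ->
  is_derive t x t' -> is_derive r x r' -> is_derive v x v' ->
  is_derive a x a' -> is_derive b x b' ->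
  is_derive (fun y => mul_flux n alpha f A B (t y) (r y) (v y) (a y) (b y)) x
    (mul_flux_diff n alpha f A B (t x) (r x) (v x) (a x) (b x) t' r' v' a' b').
Proof.
  intros Hn H0 Hf Ht Hr Hv Ha Hb.
  pose proof (is_derive_weight n r x r' Hn ltac:(lra) Hr) as Hw.
  pose proof (is_derive_potential_density n alpha f r v x r' v' H0 Hf Hr Hv) as Hp.
  unfold mul_flux_diff, mul_flux.
  pose (w := fun y : R => r y ^ (n - 1)).
  pose (p := fun y : R => potential_density n alpha f (r y) (v y)).
  change (is_derive w x ((INR n - 1) / r x * r' * r x ^ (n - 1))) in Hw.
  change (is_derive p x (potential_density_diff n alpha f (r x) (v x) r' v')) in Hp.
  apply (is_derive_ext (fun y => w y * ((A * t y + B) * (a y * b y)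
    + A * (r y * (/ 2 * (a y ^ 2 + b y ^ 2) - p y)
           + (INR n - 1) / 2 * v y * b y)))); [reflexivity|].
  assert (Hwx : r x ^ (n - 1) = w x) by reflexivity.
  assert (Hpx : potential_density n alpha f (r x) (v x) = p x) by reflexivity.
  rewrite Hwx in *. rewrite Hpx. clearbody w p.
  auto_derive.
  - repeat split; eexists; eassumption.
  - rewrite (Derive_eta _ _ _ Hr), (Derive_eta _ _ _ Hv),
      (Derive_eta _ _ _ Ht), (Derive_eta _ _ _ Ha),
      (Derive_eta _ _ _ Hb), (Derive_eta _ _ _ Hw), (Derive_eta _ _ _ Hp).
    field. lra.
Qed.

(** The law P_t = R_r - Q multiplied by t and written in the coordinates (t, s),
    r = t s: both sides are the expanded forms of d/dt (t P) + t Q and of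
    d/ds (s P + R). The equation enters through the value of u_tt. *)
Lemma divergence_identity n alpha f A B t r s v a b att atr arr :
  0 < t -> 0 < s -> r = t * s ->
  att - arr - (INR n - 1) / r * b + (INR n - 1) / 2 * (sin (2 * v) / r ^ 2)
    + f v * Derive f v / Rpower r alpha = 0 ->
  mul_density n alpha f A B t r v a b
  + t * mul_density_diff n alpha f A B t r v a b 1 s (a + s * b) (att + s * atr) (atr + s * arr)
  + t * mul_source n alpha f A r v
  = mul_density n alpha f A B t r v a b
    + s * mul_density_diff n alpha f A B t r v a b 0 t (t * b) (t * atr) (t * arr)
    + mul_flux_diff n alpha f A B t r v a b 0 t (t * b) (t * atr) (t * arr).
Proof.
  intros Ht Hs -> HE.
  assert (Hr : 0 < t * s) by nra.
  pose proof (exp_pos (alpha * ln (t * s))) as He. fold (Rpower (t * s) alpha) in He.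
  unfold mul_density_diff, mul_flux_diff, mul_density, mul_flux, mul_source,
    potential_density, potential_density_diff.
  set (E := Rpower (t * s) alpha) in *.
  assert (Hatt : att = arr + (INR n - 1) / (t * s) * b
    - (INR n - 1) / 2 * (2 * sin v * cos v / (t * s) ^ 2) - f v * Derive f v / E).
  { rewrite sin_2a in HE. lra. }
  rewrite Hatt, sin_2a. set (W := (t * s) ^ (n - 1)). field. lra.
Qed.


(** * The identity in self-similar coordinates *)

(** The hypotheses on the data in the form in which they are used, with the open
    set U on which u is smooth. *)
Record wave (n : nat) (alpha : R) (f : R -> R) (T0 : R) (u : R -> R -> R)
    (U : R * R -> Prop) : Prop := {
  wave_n : (2 <= n)%nat;
  wave_alpha1 : 2 * (INR n - 1) <= alpha;
  wave_alpha2 : INR n + 1 <= alpha;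
  wave_df : forall x, ex_derive f x;
  wave_df_cont : forall x, continuous (Derive f) x;
  wave_f0 : f 0 = 0;
  wave_df0 : Derive f 0 <> 0;
  wave_mono : forall w, 0 <= f w * Derive f w * w;
  wave_field : C2_field U u;
  wave_dom : forall p, Omega T0 p -> U p;
  wave_eq : forall t r, Omega T0 (t, r) -> 0 < r -> wave_equation_at n alpha f u t r;
  wave_axis : forall t, 0 < t <= T0 -> u t 0 = 0;
  wave_energy : finite_energy n alpha f T0 u }.

Arguments wave_n {n alpha f T0 u U} _.
Arguments wave_alpha1 {n alpha f T0 u U} _.
Arguments wave_alpha2 {n alpha f T0 u U} _.
Arguments wave_df {n alpha f T0 u U} _.
Arguments wave_df_cont {n alpha f T0 u U} _.
Arguments wave_f0 {n alpha f T0 u U} _.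
Arguments wave_df0 {n alpha f T0 u U} _.
Arguments wave_mono {n alpha f T0 u U} _.
Arguments wave_field {n alpha f T0 u U} _.
Arguments wave_dom {n alpha f T0 u U} _.
Arguments wave_eq {n alpha f T0 u U} _.
Arguments wave_axis {n alpha f T0 u U} _.
Arguments wave_energy {n alpha f T0 u U} _.

(** The law of [divergence_identity] for a solution: density, flux and source at
    the point (t, t s). *)
Definition ray_density (n : nat) (alpha : R) (f : R -> R) (A B : R)
    (u : R -> R -> R) (t s : R) : R :=
  t * mul_density n alpha f A B t (t * s) (u t (t * s)) (d_t u t (t * s)) (d_r u t (t * s)).

Definition ray_flux (n : nat) (alpha : R) (f : R -> R) (A B : R)
    (u : R -> R -> R) (t s : R) : R :=
  s * mul_density n alpha f A B t (t * s) (u t (t * s)) (d_t u t (t * s)) (d_r u t (t * s))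
  + mul_flux n alpha f A B t (t * s) (u t (t * s)) (d_t u t (t * s)) (d_r u t (t * s)).

Definition ray_source (n : nat) (alpha : R) (f : R -> R) (A : R)
    (u : R -> R -> R) (t s : R) : R :=
  t * mul_source n alpha f A (t * s) (u t (t * s)).

Lemma continuity_2d_pow (g : R -> R -> R) (k : nat) (x y : R) :
  continuity_2d_pt g x y -> continuity_2d_pt (fun x' y' => g x' y' ^ k) x y.
Proof.
  intros H. apply (continuity_1d_2d_pt_comp (fun z => z ^ k)); [|exact H].
  apply derivable_continuous_pt, derivable_pt_pow.
Qed.

Lemma continuity_pt_ex_derive (g : R -> R) (x : R) : ex_derive g x -> continuity_pt g x.
Proof.
  intros H. apply continuity_pt_filterlim, (ex_derive_continuous g x H).
Qed.

Lemma continuity_2d_Rpower (g : R -> R -> R) (al x y : R) :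
  0 < g x y -> continuity_2d_pt g x y ->
  continuity_2d_pt (fun x' y' => Rpower (g x' y') al) x y.
Proof.
  intros H0 H. apply (continuity_1d_2d_pt_comp (fun z => Rpower z al)); [|exact H].
  apply continuity_pt_ex_derive. unfold Rpower. auto_derive. exact H0.
Qed.

Lemma Rpower_pos (x y : R) : 0 < Rpower x y.
Proof. apply exp_pos. Qed.

Ltac continuity_2d :=
  unfold Rdiv;
  repeat first
    [ assumption
    | apply continuity_2d_pt_const | apply continuity_2d_pt_id1 | apply continuity_2d_pt_id2
    | apply continuity_2d_pt_plus | apply continuity_2d_pt_minus
    | apply continuity_2d_pt_mult | apply continuity_2d_pt_opp
    | apply continuity_2d_pow
    | apply continuity_2d_Rpower
    | apply continuity_2d_pt_inv
    | apply (continuity_1d_2d_pt_comp sin); [apply continuity_sin|]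
    | apply (continuity_1d_2d_pt_comp cos); [apply continuity_cos|] ].

Lemma is_derive_Rmult (g h : R -> R) (x g' h' : R) :
  is_derive g x g' -> is_derive h x h' ->
  is_derive (fun y => g y * h y) x (g' * h x + g x * h').
Proof. intros Hg Hh. apply (is_derive_mult g h x g' h' Hg Hh Rmult_comm). Qed.

Section Transport.
Context {n : nat} {alpha : R} {f : R -> R} {T0 : R} {u : R -> R -> R} {U : R * R -> Prop}.
Context (H : wave n alpha f T0 u U).

(** An open set of pairs (t, s) on which all the expressions in (t, t s) are
    differentiable; being a neighbourhood of the points with s = 1, it spares
    one-sided derivatives on the lateral boundary. *)
Definition near_ray (t s : R) : Prop := 0 < t /\ 0 < s /\ U (t, t * s).

Lemma near_ray_open t s : near_ray t s -> locally_2d near_ray t s.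
Proof.
  intros (Ht & Hs & HU).
  apply locally_2d_and; [|apply locally_2d_and].
  - apply locally_2d_locally.
    exists (mkposreal t Ht). intros [t' s'] [Hb _]. simpl in *.
    unfold ball in Hb; simpl in Hb; unfold AbsRing_ball, abs, minus, plus, opp in Hb; simpl in Hb.
    apply Rabs_def2 in Hb. lra.
  - apply locally_2d_locally.
    exists (mkposreal s Hs). intros [t' s'] [_ Hb]. simpl in *.
    unfold ball in Hb; simpl in Hb; unfold AbsRing_ball, abs, minus, plus, opp in Hb; simpl in Hb.
    apply Rabs_def2 in Hb. lra.
  - destruct (C2_open (wave_field H) HU) as [d Hd].
    assert (C : continuity_2d_pt (fun t' s' => t' * s') t s) by continuity_2d.
    destruct (C d) as [d' Hd'].
    assert (Hm : 0 < Rmin d d') by (apply Rmin_pos; apply cond_pos).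
    exists (mkposreal _ Hm). simpl. intros t' s' A B. apply Hd.
    + apply Rlt_le_trans with (1 := A), Rmin_l.
    + apply Hd'; eapply Rlt_le_trans; [exact A| |exact B|]; apply Rmin_r.
Qed.

Lemma near_ray_of_Omega t s : 0 < t <= T0 -> 0 < s <= 1 -> near_ray t s.
Proof.
  intros Ht Hs. split; [|split]; try lra. apply (wave_dom H).
  unfold Omega; simpl. nra.
Qed.

Lemma ray_continuity (g : R -> R -> R) t s :
  continuity_2d_pt g t (t * s) -> continuity_2d_pt (fun t' s' => g t' (t' * s')) t s.
Proof.
  intros Hg. apply (continuity_2d_comp g (fun t' _ => t') (fun t' s' => t' * s'));
    [exact Hg | continuity_2d..].
Qed.

Lemma ray_derivatives t s : near_ray t s ->
  (forall c1 c2 x d1 d2, c1 x = t -> c2 x = t * s -> is_derive c1 x d1 -> is_derive c2 x d2 ->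
   is_derive (fun y => u (c1 y) (c2 y)) x (d_t u t (t * s) * d1 + d_r u t (t * s) * d2) /\
   is_derive (fun y => d_t u (c1 y) (c2 y)) x
     (d_tt u t (t * s) * d1 + d_r (d_t u) t (t * s) * d2) /\
   is_derive (fun y => d_r u (c1 y) (c2 y)) x
     (d_r (d_t u) t (t * s) * d1 + d_rr u t (t * s) * d2)).
Proof.
  intros (_ & _ & HU) c1 c2 x d1 d2 E1 E2 D1 D2.
  pose proof (wave_field H) as F.
  split; [|split]; apply is_derive_comp_2d; try assumption; rewrite E1, E2.
  - apply (C2_u F), HU.
  - apply (C2_ut F), HU.
  - apply (C2_ur F), HU.
Qed.

Definition ray_density_dt A B t s : R :=
  mul_density n alpha f A B t (t * s) (u t (t * s)) (d_t u t (t * s)) (d_r u t (t * s))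
  + t * mul_density_diff n alpha f A B t (t * s) (u t (t * s)) (d_t u t (t * s)) (d_r u t (t * s))
      1 s (d_t u t (t * s) + s * d_r u t (t * s))
      (d_tt u t (t * s) + s * d_r (d_t u) t (t * s))
      (d_r (d_t u) t (t * s) + s * d_rr u t (t * s)).

Lemma is_derive_ray_density A B t s : near_ray t s ->
  is_derive (fun t' => ray_density n alpha f A B u t' s) t (ray_density_dt A B t s).
Proof.
  intros W. unfold ray_density, ray_density_dt.
  destruct (ray_derivatives t s W (fun y => y) (fun y => y * s) t 1 s) as (D1 & D2 & D3);
    [reflexivity|reflexivity| auto_derive; auto; ring | auto_derive; auto; ring |].
  destruct W as (Ht & Hs & _).
  assert (HD1 : is_derive (fun y : R => y) t 1) by (auto_derive; auto).
  assert (HDs : is_derive (fun y : R => y * s) t s) by (auto_derive; auto; ring).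
  evar_last.
  { apply (is_derive_Rmult (fun y : R => y)).
    { exact HD1. }
    apply (is_derive_mul_density n alpha f A B (fun y : R => y) (fun y => y * s)
             (fun y => u y (y * s)) (fun y => d_t u y (y * s)) (fun y => d_r u y (y * s))).
    - apply (wave_n H).
    - nra.
    - apply (wave_df H).
    - exact HD1.
    - exact HDs.
    - exact D1.
    - exact D2.
    - exact D3. }
  cbv beta. rewrite !Rmult_1_l, !Rmult_1_r, !(Rmult_comm _ s). reflexivity.
Qed.

Lemma is_derive_ray_flux A B t s : 0 < t <= T0 -> 0 < s <= 1 ->
  is_derive (fun s' => ray_flux n alpha f A B u t s') s
    (ray_density_dt A B t s + ray_source n alpha f A u t s).
Proof.
  intros Ht Hs. pose proof (near_ray_of_Omega t s Ht Hs) as W.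
  destruct (ray_derivatives t s W (fun _ => t) (fun y => t * y) s 0 t) as (D1 & D2 & D3);
    [reflexivity|reflexivity| auto_derive; auto; ring | auto_derive; auto; ring |].
  unfold ray_density_dt, ray_source.
  rewrite (divergence_identity n alpha f A B t (t * s) s _ _ _ (d_tt u t (t * s))); try lra.
  2: { apply (wave_eq H); [unfold Omega; simpl|]; nra. }
  assert (HD0 : is_derive (fun _ : R => t) s 0) by (auto_derive; auto; ring).
  assert (HD1 : is_derive (fun y : R => t * y) s t) by (auto_derive; auto; ring).
  assert (HDi : is_derive (fun y : R => y) s 1) by (auto_derive; auto).
  unfold ray_flux. evar_last.
  { apply (is_derive_plus (fun y => y * mul_density n alpha f A B t (t * y)
      (u t (t * y)) (d_t u t (t * y)) (d_r u t (t * y)))).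
    - apply (is_derive_Rmult (fun y : R => y)).
      { exact HDi. }
      apply (is_derive_mul_density n alpha f A B (fun _ : R => t) (fun y => t * y)
             (fun y => u t (t * y)) (fun y => d_t u t (t * y)) (fun y => d_r u t (t * y))).
      + apply (wave_n H).
      + nra.
      + apply (wave_df H).
      + exact HD0.
      + exact HD1.
      + exact D1.
      + exact D2.
      + exact D3.
    - apply (is_derive_mul_flux n alpha f A B (fun _ : R => t) (fun y => t * y)
             (fun y => u t (t * y)) (fun y => d_t u t (t * y)) (fun y => d_r u t (t * y))).
      + apply (wave_n H).
      + nra.
      + apply (wave_df H).
      + exact HD0.
      + exact HD1.
      + exact D1.
      + exact D2.
      + exact D3. }
  unfold plus; simpl. rewrite !Rmult_0_r, !Rplus_0_l, !Rmult_1_l, !(Rmult_comm _ t). reflexivity.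
Qed.

Lemma ray_field_continuity t s : near_ray t s ->
  continuity_2d_pt (fun t' s' => u t' (t' * s')) t s /\
  continuity_2d_pt (fun t' s' => d_t u t' (t' * s')) t s /\
  continuity_2d_pt (fun t' s' => d_r u t' (t' * s')) t s /\
  continuity_2d_pt (fun t' s' => f (u t' (t' * s'))) t s.
Proof.
  intros (Ht & Hs & HU). pose proof (wave_field H) as F.
  assert (Cu : continuity_2d_pt (fun t' s' => u t' (t' * s')) t s).
  { apply ray_continuity, (differentiable_lim_continuity _ _ _ _ _ (C2_u F HU)). }
  split; [|split; [|split]].
  - exact Cu.
  - apply ray_continuity, (differentiable_lim_continuity _ _ _ _ _ (C2_ut F HU)).
  - apply ray_continuity, (differentiable_lim_continuity _ _ _ _ _ (C2_ur F HU)).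
  - apply (continuity_1d_2d_pt_comp f); [|exact Cu].
    apply continuity_pt_ex_derive, (wave_df H).
Qed.

Lemma continuity_ray_density A B t s : near_ray t s ->
  continuity_2d_pt (ray_density n alpha f A B u) t s.
Proof.
  intros W. destruct (ray_field_continuity t s W) as (Cu & Ct & Cr & Cf).
  destruct W as (Ht & Hs & HU).
  assert (Hr : 0 < t * s) by nra.
  unfold ray_density, mul_density, potential_density.
  continuity_2d;
    apply Rgt_not_eq; first [apply pow_lt | apply Rmult_lt_0_compat; [lra | apply Rpower_pos]]; exact Hr.
Qed.

Lemma continuity_ray_density_dt A B t s : near_ray t s ->
  continuity_2d_pt (ray_density_dt A B) t s.
Proof.
  intros W. destruct (ray_field_continuity t s W) as (Cu & Ct & Cr & Cf).
  destruct W as (Ht & Hs & HU). pose proof (wave_field H) as F.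
  assert (Hr : 0 < t * s) by nra.
  assert (Cdf : continuity_2d_pt (fun t' s' => Derive f (u t' (t' * s'))) t s).
  { apply (continuity_1d_2d_pt_comp (Derive f)); [|exact Cu].
    apply continuity_pt_filterlim, (wave_df_cont H). }
  pose proof (ray_continuity _ _ _ (C2_utt F HU)) as Ctt.
  pose proof (ray_continuity _ _ _ (C2_urt F HU)) as Crt.
  pose proof (ray_continuity _ _ _ (C2_urr F HU)) as Crr.
  unfold ray_density_dt, mul_density_diff, potential_density_diff, mul_density, potential_density.
  continuity_2d;
    apply Rgt_not_eq; try exact Hr;
    first [apply pow_lt | apply Rmult_lt_0_compat; [lra | apply Rpower_pos]]; exact Hr.
Qed.

Lemma continuity_ray_source A t s : near_ray t s ->
  continuity_2d_pt (ray_source n alpha f A u) t s.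
Proof.
  intros W. destruct (ray_field_continuity t s W) as (Cu & Ct & Cr & Cf).
  destruct W as (Ht & Hs & HU).
  assert (Hr : 0 < t * s) by nra.
  assert (Cdf : continuity_2d_pt (fun t' s' => Derive f (u t' (t' * s'))) t s).
  { apply (continuity_1d_2d_pt_comp (Derive f)); [|exact Cu].
    apply continuity_pt_filterlim, (wave_df_cont H). }
  unfold ray_source, mul_source. continuity_2d; apply Rgt_not_eq; try apply Rpower_pos;
    first [apply pow_lt | apply Rmult_lt_0_compat; [lra | apply Rpower_pos]]; exact Hr.
Qed.

Lemma is_derive_ray_integral A B eps t : 0 < eps <= 1 -> 0 < t < T0 ->
  is_derive (fun t' => RInt (ray_density n alpha f A B u t') eps 1) t
    (ray_flux n alpha f A B u t 1 - ray_flux n alpha f A B u t eps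
     - RInt (ray_source n alpha f A u t) eps 1).
Proof.
  intros He Ht.
  apply (is_derive_RInt_divergence eps 1 t _ (ray_density_dt A B) (ray_flux n alpha f A B u)).
  - lra.
  - assert (Hm : 0 < Rmin t (T0 - t)) by (apply Rmin_pos; lra).
    exists (mkposreal _ Hm). intros t' Hb s Hs.
    assert (Ht' : 0 < t' < T0).
    { unfold ball in Hb; simpl in Hb; unfold AbsRing_ball, abs, minus, plus, opp in Hb; simpl in Hb.
      pose proof (Rmin_l t (T0 - t)). pose proof (Rmin_r t (T0 - t)).
      apply Rabs_def2 in Hb. lra. }
    assert (W : near_ray t' s) by (apply near_ray_of_Omega; lra).
    split; [apply continuity_ray_density, W|].
    generalize (near_ray_open t' s W). apply locally_2d_impl, locally_2d_forall.
    intros t'' s' W'. apply is_derive_ray_density, W'.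
  - intros s Hs. apply continuity_ray_density_dt, near_ray_of_Omega; lra.
  - intros s Hs. apply is_derive_ray_flux; lra.
  - intros s Hs. apply continuity_2d_section, continuity_ray_source, near_ray_of_Omega; lra.
Qed.

End Transport.


(** * Behaviour at the axis and growth of the nonlinearity *)

Lemma Rpower_le_pow (r alpha : R) (k : nat) :
  0 < r <= 1 -> INR k <= alpha -> Rpower r alpha <= r ^ k.
Proof.
  intros Hr Hk. rewrite <- Rpower_pow by lra. unfold Rpower.
  assert (Hl : ln r <= 0).
  { rewrite <- ln_1. destruct (Req_dec r 1) as [->|Hne]; [lra|].
    left. apply ln_increasing; lra. }
  destruct (Req_dec (alpha * ln r) (INR k * ln r)) as [->|Hne]; [lra|].
  left. apply exp_increasing. nra.
Qed.

Lemma pow_le_base (r : R) (k : nat) : 0 <= r <= 1 -> (1 <= k)%nat -> r ^ k <= r.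
Proof.
  intros Hr Hk. destruct k as [|k]; [lia|]. simpl.
  assert (r ^ k <= 1) by (rewrite <- (pow1 k); apply pow_incr; lra).
  pose proof (pow_le r k (proj1 Hr)). nra.
Qed.

Lemma mvt_from_zero (g g' : R -> R) (x : R) :
  (forall y, Rmin 0 x <= y <= Rmax 0 x -> is_derive g y (g' y)) -> g 0 = 0 ->
  exists c, Rmin 0 x <= c <= Rmax 0 x /\ Rabs (g x) = Rabs (g' c) * Rabs x.
Proof.
  intros Hg H0. destruct (MVT_gen g 0 x g') as (c & Hc & E).
  - intros y Hy. apply Hg. lra.
  - intros y Hy. apply continuity_pt_ex_derive. eexists. apply Hg, Hy.
  - exists c. split; [exact Hc|]. rewrite H0, !Rminus_0_r in E. rewrite E. apply Rabs_mult.
Qed.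

Lemma Rabs_between_zero (x y : R) : Rmin 0 x <= y <= Rmax 0 x -> Rabs y <= Rabs x.
Proof.
  unfold Rmin, Rmax. destruct (Rle_dec 0 x); intros Hy.
  - rewrite !Rabs_pos_eq; lra.
  - rewrite !Rabs_left1; lra.
Qed.

Lemma pow2_le_pow2_Rabs (x y : R) : Rabs x <= y -> x ^ 2 <= y ^ 2.
Proof. intros Hxy. rewrite <- (pow2_abs x). apply pow_incr. split; [apply Rabs_pos|exact Hxy]. Qed.

Lemma Rabs_le_of_pow2 (x y : R) : 0 <= y -> x ^ 2 <= y ^ 2 -> Rabs x <= y.
Proof. intros Hy Hxy. apply Rabs_le. nra. Qed.

Lemma sin_sqr_le (x : R) : sin x ^ 2 <= x ^ 2.
Proof.
  destruct (mvt_from_zero sin cos x) as (c & _ & E).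
  - intros y _. apply is_derive_sin.
  - exact sin_0.
  - rewrite <- (pow2_abs x). apply pow2_le_pow2_Rabs. rewrite E.
    rewrite <- (Rmult_1_l (Rabs x)) at 2.
    apply Rmult_le_compat_r; [apply Rabs_pos|]. apply Rabs_le, COS_bound.
Qed.

Lemma exists_pos_below (l : list R) :
  List.Forall (Rlt 0) l -> exists e, 0 < e /\ List.Forall (Rle e) l.
Proof.
  induction 1 as [|x l Hx _ (e & He & Hl)].
  - exists 1. split; [lra|constructor].
  - exists (Rmin x e). split; [apply Rmin_pos; assumption|]. constructor; [apply Rmin_l|].
    revert Hl. apply List.Forall_impl. intros y. apply Rle_trans, Rmin_r.
Qed.

(** The continuity of f' keeps |f'| >= |f'(0)|/2 near 0, and the mean value
    theorem turns this into a bound for f. *)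
Lemma linear_lower_bound_near_zero (f : R -> R) :
  (forall x, ex_derive f x) -> (forall x, continuous (Derive f) x) ->
  f 0 = 0 -> Derive f 0 <> 0 ->
  exists h d, 0 < h /\ 0 < d /\
    (forall x, Rabs x <= h -> d <= Rabs (Derive f x) /\ d * Rabs x <= Rabs (f x)).
Proof.
  intros Hd Hc H0 Hn.
  assert (Ha : 0 < Rabs (Derive f 0)) by (apply Rabs_pos_lt, Hn).
  set (d := Rabs (Derive f 0) / 2). assert (Hdp : 0 < d) by (unfold d; lra).
  pose proof (proj2 (continuity_pt_filterlim (Derive f) 0) (Hc 0)) as C.
  destruct (C d Hdp) as (h & Hh & Hb).
  assert (Hs : forall x, Rabs x <= h / 2 -> d <= Rabs (Derive f x)).
  { intros x Hx. destruct (Req_dec x 0) as [->|Hne]; [unfold d; lra|].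
    specialize (Hb x). simpl in Hb. unfold Rdist, D_x, no_cond in Hb.
    rewrite Rminus_0_r in Hb. specialize (Hb ltac:(split; [split; auto|lra])).
    pose proof (Rabs_triang_inv (Derive f 0) (Derive f 0 - Derive f x)).
    replace (Derive f 0 - (Derive f 0 - Derive f x)) with (Derive f x) in H by ring.
    rewrite (Rabs_minus_sym (Derive f 0)) in H. unfold d in *. lra. }
  exists (h / 2), d. split; [lra|]. split; [exact Hdp|].
  intros x Hx. split; [apply Hs, Hx|].
  destruct (mvt_from_zero f (Derive f) x) as (c & Hcx & E); [|exact H0|].
  { intros y _. apply Derive_correct, Hd. }
  rewrite E. apply Rmult_le_compat_r; [apply Rabs_pos|]. apply Hs.
  apply Rle_trans with (1 := Rabs_between_zero x c Hcx), Hx.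
Qed.

(** Near 0 the bound is linear; farther away f^2 is monotone on each half-line,
    since (f^2)' = 2 f f' has the sign of x. The weight 1 + x^2 makes one
    inequality cover both regimes, and x / sqrt(1 + x^2) has the smooth even
    primitive sqrt(1 + x^2). *)
Lemma growth_lower_bound (f : R -> R) :
  (forall x, ex_derive f x) -> (forall x, continuous (Derive f) x) ->
  f 0 = 0 -> Derive f 0 <> 0 -> (forall w, 0 <= f w * Derive f w * w) ->
  exists c, 0 < c /\ forall x, c ^ 2 * x ^ 2 <= f x ^ 2 * (1 + x ^ 2).
Proof.
  intros Hd Hc H0 Hn Hm.
  destruct (linear_lower_bound_near_zero f Hd Hc H0 Hn) as (h & d & Hh & Hdp & Hs).
  assert (D2 : forall y, is_derive (fun z => f z ^ 2) y (2 * (f y * Derive f y))).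
  { intros y. auto_derive; [apply Hd|]. change (Derive (fun x => f x) y) with (Derive f y). ring. }
  assert (Hsq : forall x, Rabs x <= h -> d ^ 2 * x ^ 2 <= f x ^ 2).
  { intros x Hx. rewrite <- (pow2_abs x), <- (pow2_abs (f x)), <- Rpow_mult_distr.
    apply pow_incr. split; [|apply Hs, Hx].
    apply Rmult_le_pos; [lra|apply Rabs_pos]. }
  assert (Hfar : forall x, h < Rabs x -> d ^ 2 * h ^ 2 <= f x ^ 2).
  { intros x Hx. destruct (Rle_dec 0 x) as [Hx0|Hx0].
    - rewrite Rabs_pos_eq in Hx by exact Hx0.
      apply Rle_trans with (1 := Hsq h ltac:(rewrite Rabs_pos_eq; lra)).
      destruct (MVT_gen (fun z => f z ^ 2) h x (fun y => 2 * (f y * Derive f y))) as (z & Hz & E).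
      + intros y _. apply D2.
      + intros y _. apply continuity_pt_ex_derive. eexists. apply D2.
      + rewrite Rmin_left, Rmax_right in Hz by lra. pose proof (Hm z).
        assert (0 <= f z * Derive f z) by nra. nra.
    - rewrite Rabs_left in Hx by lra.
      replace (h ^ 2) with ((- h) ^ 2) by ring.
      apply Rle_trans with (1 := Hsq (- h) ltac:(rewrite Rabs_Ropp, Rabs_pos_eq; lra)).
      destruct (MVT_gen (fun z => f z ^ 2) x (- h) (fun y => 2 * (f y * Derive f y))) as (z & Hz & E).
      + intros y _. apply D2.
      + intros y _. apply continuity_pt_ex_derive. eexists. apply D2.
      + rewrite Rmin_left, Rmax_right in Hz by lra. pose proof (Hm z).
        assert (f z * Derive f z <= 0) by nra. nra. }
  (* The factor d covers |x| <= h, and d h covers larger x. *)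
  exists (d * Rmin 1 h). assert (Hmin : 0 < Rmin 1 h) by (apply Rmin_pos; lra).
  split; [nra|]. intros x. rewrite Rpow_mult_distr.
  pose proof (pow2_ge_0 (f x)) as P1. pose proof (pow2_ge_0 x) as P2.
  destruct (Rle_dec (Rabs x) h) as [Hx|Hx].
  - assert (Rmin 1 h ^ 2 <= 1) by (pose proof (Rmin_l 1 h); nra).
    pose proof (Hsq x Hx). pose proof (pow2_ge_0 d).
    assert (0 <= d ^ 2 * x ^ 2) by (apply Rmult_le_pos; assumption).
    assert (d ^ 2 * Rmin 1 h ^ 2 * x ^ 2 <= d ^ 2 * x ^ 2) by nra.
    assert (0 <= f x ^ 2 * x ^ 2) by (apply Rmult_le_pos; assumption). lra.
  - assert (Rmin 1 h ^ 2 <= h ^ 2) by (pose proof (Rmin_r 1 h); nra).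
    pose proof (Hfar x ltac:(lra)). pose proof (pow2_ge_0 d).
    assert (d ^ 2 * Rmin 1 h ^ 2 <= f x ^ 2) by nra.
    assert (d ^ 2 * Rmin 1 h ^ 2 * x ^ 2 <= f x ^ 2 * x ^ 2) by (apply Rmult_le_compat_r; assumption).
    lra.
Qed.

Lemma bounded_near_axis (g : R -> R -> R) (S T : R) :
  S <= T -> (forall t, S <= t <= T -> continuity_2d_pt g t 0) ->
  exists M d, 0 < d /\ 0 < M /\ forall t r, S <= t <= T -> 0 <= r <= d -> Rabs (g t r) <= M.
Proof.
  intros HST Hg.
  destruct (uniform_continuity_2d_1d g S T 0 Hg (mkposreal 1 Rlt_0_1)) as [d Hd]. simpl in Hd.
  destruct (continuity_ab_maj (fun t => Rabs (g t 0)) S T HST) as (tm & Hm & _).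
  { intros t Ht. apply (continuity_pt_comp (fun t => g t 0) Rabs); [|apply Rcontinuity_abs].
    intros e He. destruct (Hg t Ht (mkposreal e He)) as [k Hk]. exists k.
    split; [apply cond_pos|]. intros z [_ Hz]. apply (Hk z 0); [exact Hz|].
    rewrite Rminus_diag, Rabs_R0. apply cond_pos. }
  exists (Rabs (g tm 0) + 1), d. split; [apply cond_pos|].
  split; [pose proof (Rabs_pos (g tm 0)); lra|].
  intros t r Ht Hr. pose proof (cond_pos d).
  specialize (Hd t 0 t r Ht ltac:(lra) Ht ltac:(lra)).
  rewrite Rminus_diag, Rabs_R0 in Hd. specialize (Hd (cond_pos d)). specialize (Hm t Ht). simpl in Hm.
  pose proof (Rabs_triang (g t r - g t 0) (g t 0)).
  replace (g t r - g t 0 + g t 0) with (g t r) in * by ring. lra.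
Qed.

Section Axis.
Context {n : nat} {alpha : R} {f : R -> R} {T0 : R} {u : R -> R -> R} {U : R * R -> Prop}.
Context (H : wave n alpha f T0 u U).

Lemma wave_INR_n : 2 <= INR n.
Proof. apply (le_INR 2), (wave_n H). Qed.

Lemma wave_alpha3 : 3 <= alpha.
Proof. pose proof wave_INR_n. pose proof (wave_alpha2 H). lra. Qed.

(** All the terms of the equation except f f'(u) / r^alpha are O(1/r), because
    u(t, 0) = 0 gives u = O(r). Hence f f'(u) = O(r^(alpha-1)), and since f' stays
    away from 0 near 0, f(u)^2 / r^alpha = O(r^(alpha-2)). The bounds are uniform
    for t in a compact interval away from t = 0. *)
Lemma bounds_near_axis (S T : R) : 0 < S -> S <= T <= T0 ->
  exists M d, 0 < M /\ 0 < d /\ forall t r, S <= t <= T -> 0 < r <= d ->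
    Rabs (u t r) <= M /\ Rabs (d_t u t r) <= M /\ Rabs (d_r u t r) <= M /\
    sin (u t r) ^ 2 / r ^ 2 <= M /\ f (u t r) ^ 2 / Rpower r alpha <= M.
Proof.
  intros HS HT. pose proof (wave_field H) as F.
  pose proof wave_INR_n as Hn. pose proof wave_alpha3 as Ha.
  assert (HO : forall t r, S <= t <= T -> 0 <= r <= S -> Omega T0 (t, r)).
  { intros t r Ht Hr. unfold Omega; simpl. lra. }
  assert (HU : forall t, S <= t <= T -> U (t, 0)).
  { intros t Ht. apply (wave_dom H), HO; lra. }
  destruct (bounded_near_axis (d_t u) S T) as (Mt & et & Het & HMt & Bt); [lra| |].
  { intros t Ht. apply (differentiable_lim_continuity _ _ _ _ _ (C2_ut F (HU t Ht))). }
  destruct (bounded_near_axis (d_r u) S T) as (Mr & er & Her & HMr & Br); [lra| |].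
  { intros t Ht. apply (differentiable_lim_continuity _ _ _ _ _ (C2_ur F (HU t Ht))). }
  destruct (bounded_near_axis (d_tt u) S T) as (Mtt & ett & Hett & HMtt & Btt); [lra| |].
  { intros t Ht. apply (C2_utt F), HU, Ht. }
  destruct (bounded_near_axis (d_rr u) S T) as (Mrr & err & Herr & HMrr & Brr); [lra| |].
  { intros t Ht. apply (C2_urr F), HU, Ht. }
  destruct (linear_lower_bound_near_zero f (wave_df H) (wave_df_cont H)
              (wave_f0 H) (wave_df0 H)) as (h & d & Hh & Hd & Hsl).
  destruct (exists_pos_below (et :: er :: ett :: err :: 1 :: S :: h / Mr :: nil))
    as (e & He0 & He).
  { repeat constructor; try lra. apply Rdiv_lt_0_compat; lra. }
  rewrite !List.Forall_cons_iff in He. destruct He as (E1 & E2 & E3 & E4 & E5 & E6 & E7 & _).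
  assert (Hur : forall t r, S <= t <= T -> 0 <= r <= e -> Rabs (u t r) <= Mr * r).
  { intros t r Ht Hr.
    destruct (mvt_from_zero (u t) (d_r u t) r) as (z & Hz & E).
    - intros y Hy. rewrite Rmin_left, Rmax_right in Hy by lra.
      assert (Uy : U (t, y)) by (apply (wave_dom H), HO; lra).
      evar_last.
      { apply (is_derive_comp_2d u (fun _ => t) (fun y => y) y _ _ 0 1 (C2_u F Uy));
          auto_derive; auto. }
      simpl. ring.
    - apply (wave_axis H). lra.
    - rewrite Rmin_left, Rmax_right in Hz by lra.
      rewrite E, (Rabs_pos_eq r) by lra. apply Rmult_le_compat_r; [lra|]. apply Br; lra. }
  (* Kf / r bounds u_tt - u_rr - (n-1) u_r / r + (n-1) sin (2u) / (2 r^2) for r <= 1. *)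
  set (Kf := Mtt + Mrr + 2 * (INR n - 1) * Mr).
  assert (HKf : 0 < Kf) by (unfold Kf; nra).
  assert (Hff : forall t r, S <= t <= T -> 0 < r <= e ->
            Rabs (f (u t r)) <= Kf / d * (Rpower r alpha / r)).
  { intros t r Ht Hr.
    pose proof (wave_eq H t r (HO t r Ht ltac:(lra)) (proj1 Hr)) as HE.
    unfold wave_equation_at in HE.
    pose proof (Hur t r Ht ltac:(lra)) as Hu.
    assert (Huh : Rabs (u t r) <= h).
    { apply Rle_trans with (1 := Hu). apply Rle_trans with (Mr * (h / Mr)).
      - apply Rmult_le_compat_l; lra.
      - apply Req_le. field. lra. }
    destruct (Hsl _ Huh) as [Hd1 _].
    pose proof (Rpower_pos r alpha) as HP.
    set (X := f (u t r) * Derive f (u t r)) in *. set (E := Rpower r alpha) in *.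
    assert (HX : X = - E * (d_tt u t r - d_rr u t r - (INR n - 1) / r * d_r u t r
                   + (INR n - 1) / 2 * (sin (2 * u t r) / r ^ 2))).
    { apply Rmult_eq_reg_r with (/ E); [|apply Rinv_neq_0_compat; lra].
      replace (- E * (d_tt u t r - d_rr u t r - (INR n - 1) / r * d_r u t r
                   + (INR n - 1) / 2 * (sin (2 * u t r) / r ^ 2)) * / E)
        with (- (d_tt u t r - d_rr u t r - (INR n - 1) / r * d_r u t r
                   + (INR n - 1) / 2 * (sin (2 * u t r) / r ^ 2))) by (field; lra).
      unfold Rdiv at 4 in HE. lra. }
    assert (HXb : Rabs X <= E * (Kf / r)).
    { rewrite HX, Rabs_mult, Rabs_Ropp, (Rabs_pos_eq E) by lra.
      apply Rmult_le_compat_l; [lra|].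
      assert (Hs : Rabs (sin (2 * u t r)) <= 2 * (Mr * r)).
      { apply Rabs_le_of_pow2; [nra|]. apply Rle_trans with (1 := sin_sqr_le _).
        rewrite <- (pow2_abs (2 * u t r)). apply pow_incr. split; [apply Rabs_pos|].
        rewrite Rabs_mult, (Rabs_pos_eq 2) by lra. lra. }
      pose proof (Btt t r Ht ltac:(lra)) as B1. pose proof (Brr t r Ht ltac:(lra)) as B2.
      pose proof (Br t r Ht ltac:(lra)) as B3.
      assert (Hi : 1 <= / r) by (rewrite <- Rinv_1; apply Rinv_le_contravar; lra).
      assert (A1 : Rabs ((INR n - 1) / r * d_r u t r) <= (INR n - 1) * Mr * / r).
      { rewrite Rabs_mult, (Rabs_pos_eq ((INR n - 1) / r)) by (apply Rmult_le_pos; lra).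
        unfold Rdiv. rewrite Rmult_assoc, (Rmult_comm (/ r)), <- Rmult_assoc.
        apply Rmult_le_compat_r; [lra|]. apply Rmult_le_compat_l; lra. }
      assert (A2 : Rabs ((INR n - 1) / 2 * (sin (2 * u t r) / r ^ 2)) <= (INR n - 1) * Mr * / r).
      { rewrite Rabs_mult, (Rabs_pos_eq ((INR n - 1) / 2)) by lra.
        unfold Rdiv at 2. rewrite Rabs_mult, (Rabs_pos_eq (/ r ^ 2)).
        2: { left. apply Rinv_0_lt_compat, pow_lt. lra. }
        replace ((INR n - 1) * Mr * / r) with ((INR n - 1) / 2 * (2 * (Mr * r) * / r ^ 2))
          by (field; lra).
        apply Rmult_le_compat_l; [lra|]. apply Rmult_le_compat_r; [|exact Hs].
        left. apply Rinv_0_lt_compat, pow_lt. lra. }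
      apply Rabs_le_between in A1. apply Rabs_le_between in A2.
      apply Rabs_le_between in B1. apply Rabs_le_between in B2.
      assert (Q1 : Mtt <= Mtt * / r) by nra. assert (Q2 : Mrr <= Mrr * / r) by nra.
      unfold Kf, Rdiv at 4. apply Rabs_le. lra. }
    unfold X in HXb. rewrite Rabs_mult in HXb.
    apply Rmult_le_reg_l with d; [exact Hd|].
    replace (d * (Kf / d * (E / r))) with (E * (Kf / r)) by (field; lra).
    apply Rle_trans with (2 := HXb). rewrite Rmult_comm.
    apply Rmult_le_compat_l; [apply Rabs_pos|exact Hd1]. }
  exists (Mt + Mr + Mr ^ 2 + (Kf / d) ^ 2), e.
  pose proof (pow2_ge_0 Mr). pose proof (pow2_ge_0 (Kf / d)).
  split; [lra|]. split; [exact He0|].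
  intros t r Ht Hr. pose proof (Hur t r Ht ltac:(lra)) as Hu.
  split; [nra|]. split; [pose proof (Bt t r Ht ltac:(lra)); lra|].
  split; [pose proof (Br t r Ht ltac:(lra)); lra|]. split.
  - apply Rle_trans with (Mr ^ 2); [|lra].
    apply Rle_div_l; [apply pow_lt; lra|]. rewrite <- Rpow_mult_distr.
    apply Rle_trans with (1 := sin_sqr_le _). rewrite <- pow2_abs.
    apply pow_incr. split; [apply Rabs_pos|exact Hu].
  - apply Rle_trans with ((Kf / d) ^ 2); [|lra].
    pose proof (Rpower_pos r alpha) as HP.
    pose proof (Rpower_le_pow r alpha 2 ltac:(lra) ltac:(simpl; lra)) as HP2.
    apply Rle_div_l; [exact HP|].
    apply Rle_trans with ((Kf / d * (Rpower r alpha / r)) ^ 2).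
    + rewrite <- pow2_abs. apply pow_incr. split; [apply Rabs_pos|]. apply Hff; lra.
    + rewrite Rpow_mult_distr. apply Rmult_le_compat_l; [assumption|].
      replace ((Rpower r alpha / r) ^ 2) with (Rpower r alpha * (Rpower r alpha / r ^ 2)) by (field; lra).
      rewrite <- (Rmult_1_r (Rpower r alpha)) at 3. apply Rmult_le_compat_l; [lra|].
      apply Rle_div_l; [apply pow_lt; lra|lra].
Qed.

End Axis.


(** * Integrals improper at the axis *)

Lemma ex_RInt_cont (g : R -> R) (a b : R) :
  a <= b -> (forall r, a <= r <= b -> continuous g r) -> ex_RInt g a b.
Proof.
  intros Hab Hg. apply (ex_RInt_continuous (V := R_CompleteNormedModule)).
  intros r Hr. rewrite Rmin_left, Rmax_right in Hr by exact Hab. auto.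
Qed.

Lemma RInt_mono_left (g : R -> R) (T a b : R) :
  (forall r, 0 < r <= T -> continuous g r) -> (forall r, 0 < r <= T -> 0 <= g r) ->
  0 < a <= b -> b <= T -> RInt g b T <= RInt g a T.
Proof.
  intros Hc Hp Ha Hb.
  rewrite <- (RInt_Chasles g a b T).
  - change (RInt g b T <= RInt g a b + RInt g b T).
    assert (0 <= RInt g a b); [|lra].
    apply RInt_ge_0; [lra| |]; [apply ex_RInt_cont; [lra|]|]; intros r Hr; [apply Hc | apply Hp]; lra.
  - apply ex_RInt_cont; [lra|]. intros r Hr. apply Hc. lra.
  - apply ex_RInt_cont; [lra|]. intros r Hr. apply Hc. lra.
Qed.

(** For an integrand continuous on (0, T] the filter definition of the improper
    integral is a limit of ordinary integrals. *)
Lemma improper_spec (g : R -> R) (T l : R) :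
  (forall r, 0 < r <= T -> continuous g r) -> 0 < T ->
  is_RInt_gen g (at_right 0) (at_point T) l <->
  (forall eta : posreal, exists d, 0 < d /\ forall a, 0 < a < d -> a <= T ->
     Rabs (RInt g a T - l) < eta).
Proof.
  intros Hc HT. split.
  - intros H eta.
    destruct (H _ (locally_ball l eta)) as [Q1 Q2 [d Hd] HQ2 HQ].
    exists d. split; [apply cond_pos|]. intros a Ha HaT.
    destruct (HQ a T) as (y & Hy & Hb).
    + apply Hd; [|lra]. unfold ball; simpl; unfold AbsRing_ball, abs, minus, plus, opp; simpl.
      rewrite Ropp_0, Rplus_0_r, Rabs_pos_eq; lra.
    + exact HQ2.
    + simpl in Hy. apply (is_RInt_unique (V := R_CompleteNormedModule)) in Hy. rewrite Hy. exact Hb.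
  - intros H P [eta HP]. destruct (H eta) as (d & Hd & Hb).
    exists (fun a => 0 < a < d /\ a <= T) (fun b => b = T).
    + assert (Hm : 0 < Rmin d T) by (apply Rmin_pos; lra).
      exists (mkposreal _ Hm). intros a Ha H0.
      unfold ball in Ha; simpl in Ha; unfold AbsRing_ball, abs, minus, plus, opp in Ha; simpl in Ha.
      pose proof (Rmin_l d T). pose proof (Rmin_r d T).
      rewrite Ropp_0, Rplus_0_r, Rabs_pos_eq in Ha; lra.
    + reflexivity.
    + intros a b [Ha HaT] ->. exists (RInt g a T). split.
      * apply (RInt_correct (V := R_CompleteNormedModule)). apply ex_RInt_cont; [exact HaT|].
        intros r Hr. apply Hc. lra.
      * apply HP. apply (Hb a Ha HaT).
Qed.

Lemma improper_le (g : R -> R) (T l : R) :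
  (forall r, 0 < r <= T -> continuous g r) -> (forall r, 0 < r <= T -> 0 <= g r) ->
  0 < T -> is_RInt_gen g (at_right 0) (at_point T) l ->
  forall a, 0 < a <= T -> RInt g a T <= l.
Proof.
  intros Hc Hp HT Hl a Ha. pose proof (proj1 (improper_spec g T l Hc HT) Hl) as Hs.
  apply Rnot_lt_le. intros Hlt.
  assert (He : 0 < RInt g a T - l) by lra.
  destruct (Hs (mkposreal _ He)) as (d & Hd & Hb). simpl in Hb.
  set (b := Rmin a (d / 2)).
  assert (0 < b /\ b <= a /\ b <= d / 2).
  { unfold b. split; [apply Rmin_pos; lra|]. split; [apply Rmin_l|apply Rmin_r]. }
  specialize (Hb b ltac:(lra) ltac:(lra)). apply Rabs_def2 in Hb.
  pose proof (RInt_mono_left g T b a Hc Hp ltac:(lra) ltac:(lra)). lra.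
Qed.

Lemma improper_bounded (g : R -> R) (T B : R) :
  (forall r, 0 < r <= T -> continuous g r) -> (forall r, 0 < r <= T -> 0 <= g r) ->
  0 < T -> (forall a, 0 < a <= T -> RInt g a T <= B) ->
  exists l, is_RInt_gen g (at_right 0) (at_point T) l /\ 0 <= l <= B.
Proof.
  intros Hc Hp HT HB.
  destruct (completeness (fun y => exists a, 0 < a <= T /\ y = RInt g a T)) as [l [Hub Hlub]].
  - exists B. intros y (a & Ha & ->). apply HB, Ha.
  - exists (RInt g T T), T. split; [lra|reflexivity].
  - exists l. split; [|split].
    + apply (proj2 (improper_spec g T l Hc HT)). intros eta.
      assert (Hex : exists a, 0 < a <= T /\ l - eta < RInt g a T).
      { apply Classical_Prop.NNPP. intros Hn.
        assert (l <= l - eta); [|pose proof (cond_pos eta); lra].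
        apply Hlub. intros y (a & Ha & ->). apply Rnot_lt_le. intros Hlt.
        apply Hn. exists a. split; assumption. }
      destruct Hex as (a0 & Ha0 & Hlt). exists a0. split; [lra|]. intros a Ha HaT.
      pose proof (RInt_mono_left g T a a0 Hc Hp ltac:(lra) ltac:(lra)).
      assert (RInt g a T <= l) by (apply Hub; exists a; split; [lra|reflexivity]).
      apply Rabs_def1; pose proof (cond_pos eta); lra.
    + apply Hub. exists T. split; [lra|]. symmetry. apply (RInt_point (V := R_CompleteNormedModule)).
    + apply Hlub. intros y (a & Ha & ->). apply HB, Ha.
Qed.

Lemma ray_rescale (g : R -> R) (t eps : R) :
  0 < t -> 0 < eps <= 1 -> (forall r, 0 < r <= t -> continuous g r) ->
  RInt (fun s => t * g (t * s)) eps 1 = RInt g (t * eps) t.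
Proof.
  intros Ht He Hc.
  pose proof (RInt_comp_lin (V := R_CompleteNormedModule) g t 0 eps 1) as E.
  rewrite !Rplus_0_r, Rmult_1_r in E. rewrite <- E.
  - apply RInt_ext. intros s _. rewrite Rplus_0_r. reflexivity.
  - apply ex_RInt_cont; [nra|]. intros r Hr. apply Hc. nra.
Qed.


(** * Pointwise inequalities for the multiplier *)

Lemma sin_term_nonneg (v r : R) : 0 < r -> 0 <= sin v ^ 2 / r ^ 2.
Proof.
  intros Hr. apply Rmult_le_pos; [apply pow2_ge_0|].
  left. apply Rinv_0_lt_compat, pow_lt, Hr.
Qed.

Lemma f_term_nonneg (alpha : R) (f : R -> R) (v r : R) : 0 <= f v ^ 2 / Rpower r alpha.
Proof.
  apply Rmult_le_pos; [apply pow2_ge_0|]. left. apply Rinv_0_lt_compat, Rpower_pos.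
Qed.

Lemma f_term_half (alpha : R) (f : R -> R) (v r : R) :
  f v ^ 2 / (2 * Rpower r alpha) = f v ^ 2 / Rpower r alpha / 2.
Proof. pose proof (Rpower_pos r alpha). field. lra. Qed.

Section Pointwise.
Context (n : nat) (alpha : R) (f : R -> R) (K t r v a b : R).
Context (Hn : 2 <= INR n) (Ha : 3 <= alpha) (Hr : 0 < r <= t) (Ht : t <= 1)
  (HK : 0 < K) (Hv : v ^ 2 <= K * f v ^ 2).

Let m := (INR n - 1) / 2.
Let w := r ^ (n - 1).
Let X := f v ^ 2 / Rpower r alpha.
Let Y := sin v ^ 2 / r ^ 2.

Lemma potential_density_XY : potential_density n alpha f r v = m * Y + X / 2.
Proof. unfold potential_density. rewrite f_term_half. reflexivity. Qed.

Lemma X_nonneg : 0 <= X.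
Proof. apply f_term_nonneg. Qed.

Lemma Y_nonneg : 0 <= Y.
Proof. apply sin_term_nonneg. lra. Qed.

Lemma weight_pos : 0 < w.
Proof. apply pow_lt. lra. Qed.

(** The source of smallness: in height squared, the potential energy X controls
    three powers of r. *)
Lemma v_sqr_le : v ^ 2 <= K * X * r ^ 3.
Proof.
  apply Rle_trans with (1 := Hv). rewrite Rmult_assoc. apply Rmult_le_compat_l; [lra|].
  pose proof (Rpower_pos r alpha).
  replace (f v ^ 2) with (X * Rpower r alpha) by (unfold X; field; lra).
  apply Rmult_le_compat_l; [apply X_nonneg|].
  apply Rpower_le_pow; [lra|]. simpl. lra.
Qed.

Lemma mul_density_energy : mul_density n alpha f 0 1 t r v a b
  = w * (/ 2 * (a ^ 2 + b ^ 2) + m * Y + X / 2).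
Proof. unfold mul_density. rewrite potential_density_XY. fold w. ring. Qed.

(** AM-GM with the weight t q, where q is the square root of t: this weight is
    o(t), and v^2 <= K X (t q)^2 is just enough to absorb the other half. *)
Lemma cross_term q : 0 < q -> q * q = t ->
  Rabs (v * a) <= t * q * (1 + K) * (/ 2 * (a ^ 2 + b ^ 2) + m * Y + X / 2).
Proof.
  intros Hq Hqt. pose proof X_nonneg as HX. pose proof Y_nonneg as HY.
  assert (HmY : 0 <= m * Y) by (apply Rmult_le_pos; [unfold m; lra|assumption]).
  assert (Hr3 : r ^ 3 <= t ^ 3) by (apply pow_incr; lra).
  assert (HvX : v ^ 2 <= K * X * (t * q) ^ 2).
  { apply Rle_trans with (1 := v_sqr_le).
    replace ((t * q) ^ 2) with (t ^ 3) by (rewrite <- Hqt; ring).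
    apply Rmult_le_compat_l; [nra|exact Hr3]. }
  set (p := t * q) in *. assert (Hp : 0 < p) by (unfold p; nra).
  assert (Habs : 2 * Rabs (v * a) <= p * (a ^ 2 + K * X)).
  { apply Rmult_le_reg_l with p; [exact Hp|].
    unfold Rabs. destruct (Rcase_abs (v * a)).
    - pose proof (pow2_ge_0 (p * a + v)). nra.
    - pose proof (pow2_ge_0 (p * a - v)). nra. }
  assert (a ^ 2 + K * X <= 2 * ((1 + K) * (/ 2 * (a ^ 2 + b ^ 2) + m * Y + X / 2))).
  { pose proof (pow2_ge_0 a). pose proof (pow2_ge_0 b).
    assert (0 <= K * (a ^ 2 + b ^ 2 + 2 * (m * Y))) by (apply Rmult_le_pos; lra).
    assert (0 <= K * X) by (apply Rmult_le_pos; lra). nra. }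
  assert (p * (a ^ 2 + K * X) <= p * (2 * ((1 + K) * (/ 2 * (a ^ 2 + b ^ 2) + m * Y + X / 2))))
    by (apply Rmult_le_compat_l; lra).
  lra.
Qed.

(** Besides [cross_term] this is the identity
    4 (t e + r a b) = (t - r)(a - b)^2 + (t + r)(a + b)^2 + 4 t V. *)
Lemma mul_density_lower B q : 0 < q -> q * q = t ->
  t / 4 * (w * ((1 - r / t) * (a - b) ^ 2 + (a + b) ^ 2 + Y + X))
  + (B - m * (1 + K) * (t * q)) * mul_density n alpha f 0 1 t r v a b
  <= mul_density n alpha f 1 B t r v a b.
Proof.
  intros Hq Hqt. pose proof (cross_term q Hq Hqt) as Hc. rewrite mul_density_energy.
  unfold mul_density. rewrite potential_density_XY. fold w m.
  set (e := / 2 * (a ^ 2 + b ^ 2) + m * Y + X / 2) in *.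
  replace (/ 2 * (a ^ 2 + b ^ 2) + (m * Y + X / 2)) with e by (unfold e; ring).
  pose proof weight_pos as Hw. pose proof X_nonneg as HX. pose proof Y_nonneg as HY.
  assert (H1 : t / 4 * ((1 - r / t) * (a - b) ^ 2 + (a + b) ^ 2 + Y + X) <= t * e + r * a * b).
  { replace (t / 4 * ((1 - r / t) * (a - b) ^ 2 + (a + b) ^ 2 + Y + X))
      with (((t - r) * (a - b) ^ 2 + t * (a + b) ^ 2 + t * Y + t * X) / 4) by (field; lra).
    assert (0 <= r * (a + b) ^ 2) by (apply Rmult_le_pos; [lra|apply pow2_ge_0]).
    assert (0 <= t * X) by (apply Rmult_le_pos; lra).
    assert (0 <= t * (4 * m - 1) * Y).
    { apply Rmult_le_pos; [apply Rmult_le_pos; unfold m; lra|exact HY]. }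
    unfold e. nra. }
  assert (H2 : - (m * (1 + K) * (t * q) * e) <= m * v * a).
  { assert (- Rabs (v * a) <= v * a) by (pose proof (Rle_abs (- (v * a))); rewrite Rabs_Ropp in *; lra).
    assert (Hm : 0 <= m) by (unfold m; lra).
    assert (m * - (t * q * (1 + K) * e) <= m * (v * a)) by (apply Rmult_le_compat_l; lra).
    lra. }
  apply Rle_trans with (w * (t / 4 * ((1 - r / t) * (a - b) ^ 2 + (a + b) ^ 2 + Y + X)
    + (B - m * (1 + K) * (t * q)) * e)); [apply Req_le; ring|].
  apply Rmult_le_compat_l; lra.
Qed.

Lemma mul_density_upper B q : 0 < q -> q * q = t ->
  mul_density n alpha f 1 B t r v a b
  <= (B + (2 + m * (1 + K)) * t) * mul_density n alpha f 0 1 t r v a b.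
Proof.
  intros Hq Hqt. pose proof (cross_term q Hq Hqt) as Hc. rewrite mul_density_energy.
  unfold mul_density. rewrite potential_density_XY. fold w m.
  set (e := / 2 * (a ^ 2 + b ^ 2) + m * Y + X / 2) in *.
  replace (/ 2 * (a ^ 2 + b ^ 2) + (m * Y + X / 2)) with e by (unfold e; ring).
  pose proof weight_pos as Hw. pose proof X_nonneg as HX. pose proof Y_nonneg as HY.
  assert (HmY : 0 <= m * Y) by (apply Rmult_le_pos; [unfold m; lra|assumption]).
  assert (Hm : 0 <= m) by (unfold m; lra).
  assert (He : 0 <= e).
  { unfold e. pose proof (pow2_ge_0 a). pose proof (pow2_ge_0 b). lra. }
  assert (Hq1 : q <= 1) by nra.
  assert (H1 : r * a * b <= t * e).
  { assert (t * (/ 2 * (a ^ 2 + b ^ 2)) <= t * e) by (apply Rmult_le_compat_l; unfold e; lra).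
    assert (0 <= t * (a - b) ^ 2) by (apply Rmult_le_pos; [lra|apply pow2_ge_0]).
    assert (0 <= r * (a + b) ^ 2) by (apply Rmult_le_pos; [lra|apply pow2_ge_0]).
    assert (0 <= (t - r) * (a ^ 2 + b ^ 2)) by (apply Rmult_le_pos; [lra|]; nra).
    nra. }
  assert (H2 : m * v * a <= m * (1 + K) * t * e).
  { pose proof (Rle_abs (v * a)).
    assert (m * (v * a) <= m * (t * q * (1 + K) * e)) by (apply Rmult_le_compat_l; lra).
    assert (0 <= m * (1 + K) * t * e) by (repeat apply Rmult_le_pos; lra).
    assert (m * (1 + K) * t * e * q <= m * (1 + K) * t * e * 1) by (apply Rmult_le_compat_l; lra).
    lra. }
  apply Rle_trans with (w * ((B + (2 + m * (1 + K)) * t) * e)); [|apply Req_le; ring].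
  apply Rmult_le_compat_l; lra.
Qed.

(** The f-terms of the source are nonnegative; the trigonometric ones are at most
    4 m^2 v^2 / r^2, which [v_sqr_le] bounds by t X. *)
Lemma mul_source_lower : 0 <= f v * Derive f v * v -> INR n + 1 <= alpha ->
  - mul_source n alpha f 1 r v <= 8 * m ^ 2 * K * t * mul_density n alpha f 0 1 t r v a b.
Proof.
  intros Hm Hal. rewrite mul_density_energy. unfold mul_source. fold w.
  pose proof weight_pos as Hw. pose proof X_nonneg as HX. pose proof Y_nonneg as HY.
  pose proof (Rpower_pos r alpha) as HE.
  rewrite f_term_half. fold X.
  fold Y. fold m. replace ((INR n - 1) ^ 2 / 2) with (2 * m ^ 2) by (unfold m; field).
  set (Z := v ^ 2 / r ^ 2).
  assert (Hr2 : 0 < r ^ 2) by (apply pow_lt; lra).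
  assert (HZ : Z <= K * X * t).
  { unfold Z. apply Rle_div_l; [exact Hr2|]. apply Rle_trans with (1 := v_sqr_le).
    rewrite (Rmult_assoc (K * X) t). apply Rmult_le_compat_l; [nra|].
    replace (r ^ 3) with (r * r ^ 2) by ring. apply Rmult_le_compat_r; lra. }
  assert (HYZ : Y <= Z).
  { unfold Y, Z. apply Rmult_le_compat_r; [left; apply Rinv_0_lt_compat, Hr2|apply sin_sqr_le]. }
  assert (HS : - (2 * Z) <= v * sin (2 * v) / r ^ 2).
  { unfold Z. replace (- (2 * (v ^ 2 / r ^ 2))) with (- (2 * v ^ 2) / r ^ 2) by (field; lra).
    apply Rmult_le_compat_r; [left; apply Rinv_0_lt_compat, Hr2|].
    pose proof (sin_sqr_le (2 * v)). pose proof (pow2_ge_0 (2 * v + sin (2 * v))). nra. }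
  assert (HF : 0 <= f v * Derive f v * v / Rpower r alpha).
  { apply Rmult_le_pos; [exact Hm|]. left. apply Rinv_0_lt_compat, HE. }
  set (G := v * sin (2 * v) / r ^ 2) in *.
  set (F := f v * Derive f v * v / Rpower r alpha) in *.
  assert (Hmp : 0 <= m) by (unfold m; lra).
  assert (0 <= m * F) by (apply Rmult_le_pos; assumption).
  assert (Hm2 : 0 <= m ^ 2) by apply pow2_ge_0.
  assert (m ^ 2 * - (2 * Z) <= m ^ 2 * G) by (apply Rmult_le_compat_l; assumption).
  assert (m ^ 2 * Y <= m ^ 2 * Z) by (apply Rmult_le_compat_l; assumption).
  assert (m ^ 2 * Z <= m ^ 2 * (K * X * t)) by (apply Rmult_le_compat_l; assumption).
  assert (0 <= (alpha - INR n - 1) * (X / 2)) by (apply Rmult_le_pos; lra).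
  assert (0 <= 8 * m ^ 2 * K * t * (/ 2 * (a ^ 2 + b ^ 2) + m * Y)).
  { apply Rmult_le_pos; [apply Rmult_le_pos; [apply Rmult_le_pos|]; lra|].
    pose proof (pow2_ge_0 a). pose proof (pow2_ge_0 b).
    assert (0 <= m * Y) by (apply Rmult_le_pos; assumption). lra. }
  apply Rle_trans with (w * (- (1 * (m * (m * G + F) - 2 * m ^ 2 * Y
     + (alpha - INR n - 1) * (X / 2))))); [apply Req_le; ring|].
  apply Rle_trans with (w * (8 * m ^ 2 * K * t * (/ 2 * (a ^ 2 + b ^ 2) + m * Y + X / 2)));
    [|apply Req_le; ring].
  apply Rmult_le_compat_l; [lra|]. nra.
Qed.

(** At r = t the potential cancels between P and R in the scaling part, so that
    only the outgoing derivative a + b survives there. *)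
Lemma cone_flux c A : r = t ->
  mul_density n alpha f A c t r v a b + mul_flux n alpha f A c t r v a b
  = w * (A * (t * (a + b) ^ 2 + m * v * (a + b)) + c * (/ 2 * (a + b) ^ 2 + m * Y + X / 2)).
Proof.
  intros E. unfold mul_density, mul_flux. rewrite potential_density_XY. fold w m. rewrite E. field.
Qed.

Lemma cone_flux_energy : r = t ->
  0 <= mul_density n alpha f 0 1 t r v a b + mul_flux n alpha f 0 1 t r v a b.
Proof.
  intros E. rewrite cone_flux by exact E.
  pose proof weight_pos. pose proof X_nonneg. pose proof Y_nonneg.
  assert (0 <= m * Y) by (apply Rmult_le_pos; [unfold m; lra|assumption]).
  apply Rmult_le_pos; [lra|]. pose proof (pow2_ge_0 (a + b)). lra.
Qed.

(** The scaling flux through the cone is dominated by t times the energy flux: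
    this fixes how much energy has to be subtracted. *)
Lemma cone_flux_morawetz c : r = t -> (2 + m + m * K) * t <= c ->
  mul_density n alpha f 1 (- c) t r v a b + mul_flux n alpha f 1 (- c) t r v a b <= 0.
Proof.
  intros E Hc. rewrite cone_flux by exact E.
  pose proof weight_pos. pose proof X_nonneg as HX. pose proof Y_nonneg as HY.
  assert (Hm : 0 <= m) by (unfold m; lra).
  assert (HmY : 0 <= m * Y) by (apply Rmult_le_pos; assumption).
  set (g := a + b). pose proof (pow2_ge_0 g) as Hg.
  assert (Hvg : 2 * (v * g) <= t * g ^ 2 + K * X * t).
  { apply Rmult_le_reg_l with t; [lra|].
    assert (HvX : v ^ 2 <= K * X * (t * t)).
    { apply Rle_trans with (1 := v_sqr_le). apply Rmult_le_compat_l; [nra|]. rewrite E. nra. }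
    pose proof (pow2_ge_0 (t * g - v)). nra. }
  assert (H1 : m * (2 * (v * g)) <= m * (t * g ^ 2 + K * X * t))
    by (apply Rmult_le_compat_l; assumption).
  assert (H2 : (2 + m + m * K) * t * (/ 2 * g ^ 2 + m * Y + X / 2)
    <= c * (/ 2 * g ^ 2 + m * Y + X / 2)) by (apply Rmult_le_compat_r; lra).
  assert (0 <= m * K * t * (/ 2 * g ^ 2))
    by (apply Rmult_le_pos; [repeat apply Rmult_le_pos|]; lra).
  assert (0 <= (2 + m + m * K) * t * (m * Y)).
  { assert (0 <= m * K) by (apply Rmult_le_pos; lra). apply Rmult_le_pos; [apply Rmult_le_pos|]; lra. }
  assert (0 <= (2 + m) * t * (X / 2))
    by (apply Rmult_le_pos; [apply Rmult_le_pos|]; lra).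
  assert (G : 1 * (t * g ^ 2 + m * v * g) + - c * (/ 2 * g ^ 2 + m * Y + X / 2) <= 0) by nra.
  apply Ropp_le_cancel. rewrite Ropp_0, Ropp_mult_distr_r. apply Rmult_le_pos; lra.
Qed.

End Pointwise.


(** * The energy and its monotonicity *)

Lemma increment_le (g g' : R -> R) (c a b : R) : a <= b ->
  (forall t, a <= t <= b -> is_derive g t (g' t)) -> (forall t, a <= t <= b -> g' t <= c) ->
  g b - g a <= c * (b - a).
Proof.
  intros Hab Hd Hc. destruct (MVT_gen g a b g') as (z & Hz & E).
  - intros t Ht. rewrite Rmin_left, Rmax_right in Ht by lra. apply Hd. lra.
  - intros t Ht. rewrite Rmin_left, Rmax_right in Ht by lra.
    apply continuity_pt_ex_derive. eexists. apply Hd, Ht.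
  - rewrite Rmin_left, Rmax_right in Hz by lra. rewrite E.
    apply Rmult_le_compat_r; [lra|]. apply Hc, Hz.
Qed.

Section Energy.
Context {n : nat} {alpha : R} {f : R -> R} {T0 : R} {u : R -> R -> R} {U : R * R -> Prop}.
Context (H : wave n alpha f T0 u U).

Definition slice_energy (t : R) : R :=
  RInt_gen (radial n (energy_density n alpha f u) t) (at_right 0) (at_point t).

Definition ray_energy (eps t : R) : R := RInt (ray_density n alpha f 0 1 u t) eps 1.

Lemma field_continuity t r : Omega T0 (t, r) ->
  continuity_2d_pt u t r /\ continuity_2d_pt (d_t u) t r /\ continuity_2d_pt (d_r u) t r /\
  continuity_2d_pt (fun t' r' => f (u t' r')) t r.
Proof.
  intros HO. pose proof (wave_dom H _ HO) as HU.
  pose proof (wave_field H) as F.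
  pose proof (differentiable_lim_continuity _ _ _ _ _ (C2_u F HU)) as Cu.
  split; [exact Cu|]. split; [|split].
  - apply (differentiable_lim_continuity _ _ _ _ _ (C2_ut F HU)).
  - apply (differentiable_lim_continuity _ _ _ _ _ (C2_ur F HU)).
  - apply (continuity_1d_2d_pt_comp f); [|exact Cu].
    apply continuity_pt_ex_derive, (wave_df H).
Qed.

Lemma Omega_slice t r : 0 < t <= T0 -> 0 < r <= t -> Omega T0 (t, r).
Proof. intros Ht Hr. unfold Omega; simpl. lra. Qed.

Ltac slice_continuity Ht Hr :=
  let HO := fresh in pose proof (Omega_slice _ _ Ht Hr) as HO;
  destruct (field_continuity _ _ HO) as (? & ? & ? & ?);
  apply continuity_2d_section; unfold radial, energy_density, decaying_density; continuity_2d;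
  first [lra | apply Rgt_not_eq];
  first [apply pow_lt; lra | apply Rpower_pos
        | apply Rmult_lt_0_compat; [lra|apply Rpower_pos] | lra].

Lemma energy_continuous t : 0 < t <= T0 ->
  forall r, 0 < r <= t -> continuous (radial n (energy_density n alpha f u) t) r.
Proof. intros Ht r Hr. slice_continuity Ht Hr. Qed.

Lemma decaying_continuous t : 0 < t <= T0 ->
  forall r, 0 < r <= t -> continuous (radial n (decaying_density alpha f u) t) r.
Proof. intros Ht r Hr. slice_continuity Ht Hr. Qed.

Lemma potential_continuous t : 0 < t <= T0 -> forall r, 0 < r <= t ->
  continuous (radial n (fun t' r' => f (u t' r') ^ 2 / Rpower r' alpha) t) r.
Proof. intros Ht r Hr. slice_continuity Ht Hr. Qed.

Lemma radial_derivative_continuous t : 0 < t <= T0 -> forall r, 0 < r <= t ->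
  continuous (radial n (fun t' r' => d_r u t' r' ^ 2) t) r.
Proof. intros Ht r Hr. slice_continuity Ht Hr. Qed.

Lemma energy_density_lower t r : 0 < r ->
  d_t u t r ^ 2 + d_r u t r ^ 2 + sin (u t r) ^ 2 / r ^ 2 + f (u t r) ^ 2 / Rpower r alpha
  <= 2 * energy_density n alpha f u t r.
Proof.
  intros Hr. unfold energy_density. rewrite f_term_half.
  pose proof (sin_term_nonneg (u t r) r Hr) as HY. pose proof (wave_INR_n H) as Hn.
  set (Y := sin (u t r) ^ 2 / r ^ 2) in *.
  assert (0 <= (INR n - 2) * Y) by (apply Rmult_le_pos; lra). lra.
Qed.

Lemma energy_nonneg t r : 0 < r -> 0 <= radial n (energy_density n alpha f u) t r.
Proof.
  intros Hr. apply Rmult_le_pos; [|apply pow_le; lra].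
  pose proof (energy_density_lower t r Hr). pose proof (sin_term_nonneg (u t r) r Hr).
  pose proof (f_term_nonneg alpha f (u t r) r). pose proof (pow2_ge_0 (d_t u t r)).
  pose proof (pow2_ge_0 (d_r u t r)). lra.
Qed.

Lemma decaying_bounds t r : 0 < r <= t ->
  0 <= radial n (decaying_density alpha f u) t r
    <= 4 * radial n (energy_density n alpha f u) t r.
Proof.
  intros Hr. unfold radial. pose proof (pow_lt r (n - 1) (proj1 Hr)) as Hw.
  pose proof (energy_density_lower t r (proj1 Hr)).
  pose proof (sin_term_nonneg (u t r) r (proj1 Hr)). pose proof (f_term_nonneg alpha f (u t r) r).
  assert (Hq : 0 <= r / t <= 1).
  { split; [apply Rmult_le_pos; [lra|left; apply Rinv_0_lt_compat; lra]|].
    apply Rle_div_l; lra. }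
  assert (D : 0 <= decaying_density alpha f u t r <= 4 * energy_density n alpha f u t r).
  { unfold decaying_density.
    set (a := d_t u t r) in *. set (b := d_r u t r) in *.
    pose proof (pow2_ge_0 (a - b)). pose proof (pow2_ge_0 (a + b)).
    assert (0 <= (1 - r / t) * (a - b) ^ 2) by (apply Rmult_le_pos; lra).
    assert (0 <= r / t * (a - b) ^ 2) by (apply Rmult_le_pos; lra).
    pose proof (pow2_ge_0 a). pose proof (pow2_ge_0 b).
    split; [lra|]. nra. }
  split; nra.
Qed.

Lemma is_slice_energy t : 0 < t <= T0 ->
  is_RInt_gen (radial n (energy_density n alpha f u) t) (at_right 0) (at_point t)
    (slice_energy t).
Proof.
  intros Ht. apply (RInt_gen_correct (V := R_CompleteNormedModule)).
  apply (wave_energy H t Ht).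
Qed.

Lemma energy_truncated_le t a : 0 < t <= T0 -> 0 < a <= t ->
  RInt (radial n (energy_density n alpha f u) t) a t <= slice_energy t.
Proof.
  intros Ht Ha. apply improper_le; try assumption; try lra.
  - apply energy_continuous, Ht.
  - intros r Hr. apply energy_nonneg. lra.
  - apply is_slice_energy, Ht.
Qed.

Lemma ray_density_energy t s :
  ray_density n alpha f 0 1 u t s = t * radial n (energy_density n alpha f u) t (t * s).
Proof. unfold ray_density, mul_density, radial, energy_density, potential_density. ring. Qed.

Lemma ray_energy_rescale eps t : 0 < t <= T0 -> 0 < eps <= 1 ->
  ray_energy eps t = RInt (radial n (energy_density n alpha f u) t) (t * eps) t.
Proof.
  intros Ht He. unfold ray_energy. rewrite <- ray_rescale; try lra.
  - apply RInt_ext. intros s _. apply ray_density_energy.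
  - apply energy_continuous, Ht.
Qed.

Lemma ray_energy_le eps t : 0 < t <= T0 -> 0 < eps <= 1 -> ray_energy eps t <= slice_energy t.
Proof.
  intros Ht He. rewrite ray_energy_rescale by assumption.
  apply energy_truncated_le; [exact Ht|]. nra.
Qed.

Lemma ray_energy_approx t eta : 0 < t <= T0 -> 0 < eta ->
  exists d, 0 < d /\ forall eps, 0 < eps < d -> eps <= 1 -> slice_energy t - eta < ray_energy eps t.
Proof.
  intros Ht Heta.
  destruct (proj1 (improper_spec _ t _ (energy_continuous t Ht) (proj1 Ht))
              (is_slice_energy t Ht) (mkposreal eta Heta)) as (d & Hd & Hb). simpl in Hb.
  exists (d / t). split; [apply Rdiv_lt_0_compat; lra|].
  intros eps He He1. rewrite ray_energy_rescale by lra.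
  assert (t * eps < d).
  { apply Rlt_le_trans with (t * (d / t)); [apply Rmult_lt_compat_l; lra|].
    apply Req_le. field. lra. }
  specialize (Hb (t * eps) ltac:(split; nra) ltac:(nra)). apply Rabs_def2 in Hb. lra.
Qed.

Lemma ray_continuous A B t s : 0 < t <= T0 -> 0 < s <= 1 ->
  continuous (ray_density n alpha f A B u t) s.
Proof.
  intros Ht Hs. apply continuity_2d_section, (continuity_ray_density H), (near_ray_of_Omega H); assumption.
Qed.

Lemma ex_RInt_ray A B eps t : 0 < t <= T0 -> 0 < eps <= 1 ->
  ex_RInt (ray_density n alpha f A B u t) eps 1.
Proof.
  intros Ht He. apply ex_RInt_cont; [lra|]. intros s Hs. apply ray_continuous; lra.
Qed.

Lemma ray_density_energy_nonneg t s : 0 < t <= T0 -> 0 < s -> 0 <= ray_density n alpha f 0 1 u t s.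
Proof.
  intros Ht Hs. rewrite ray_density_energy. apply Rmult_le_pos; [lra|]. apply energy_nonneg. nra.
Qed.

Lemma slice_energy_nonneg t : 0 < t <= T0 -> 0 <= slice_energy t.
Proof.
  intros Ht. apply Rle_trans with (2 := energy_truncated_le t t Ht ltac:(lra)).
  apply Req_le. symmetry. apply (RInt_point (V := R_CompleteNormedModule)).
Qed.

(** The weight r^(n-1) <= r makes the flux through the line r = t eps vanish with
    eps, because all the other factors stay bounded there. *)
Lemma ray_flux_axis A B S T : 0 < S -> S <= T <= T0 -> T <= 1 ->
  exists C d, 0 < C /\ 0 < d <= 1 /\ forall t eps, S <= t <= T -> 0 < eps <= d ->
    Rabs (ray_flux n alpha f A B u t eps) <= C * eps.
Proof.
  intros HS HT HT1. destruct (bounds_near_axis H S T HS HT) as (M & d & HM & Hd & Hb).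
  pose proof (wave_INR_n H) as Hn.
  set (N := INR n - 1). assert (HN : 1 <= N) by (unfold N; lra).
  set (P0 := M ^ 2 + N * M + M).
  set (C := 2 * ((Rabs A + Rabs B) * P0 + Rabs A * (P0 + N * M ^ 2)) + 1).
  pose proof (Rabs_pos A) as HA. pose proof (Rabs_pos B) as HB.
  assert (HP0 : 0 <= P0) by (unfold P0; nra).
  assert (HAB : 0 <= (Rabs A + Rabs B) * P0) by (apply Rmult_le_pos; lra).
  assert (HA2 : 0 <= Rabs A * (P0 + N * M ^ 2)) by (apply Rmult_le_pos; [lra|nra]).
  exists C, (Rmin 1 d). split; [unfold C; lra|].
  split; [split; [apply Rmin_pos; lra | apply Rmin_l]|].
  intros t eps Ht He.
  assert (He1 : eps <= 1) by (apply Rle_trans with (1 := proj2 He), Rmin_l).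
  assert (Hed : eps <= d) by (apply Rle_trans with (1 := proj2 He), Rmin_r).
  set (r := t * eps). assert (Hr : 0 < r <= eps) by (unfold r; nra).
  destruct (Hb t r Ht ltac:(lra)) as (Hu & Hut & Hur & HY & HX).
  unfold ray_flux. fold r.
  set (v := u t r) in *. set (a := d_t u t r) in *. set (b := d_r u t r) in *.
  assert (Hpot : 0 <= potential_density n alpha f r v <= N * M + M).
  { unfold potential_density. rewrite f_term_half. fold N.
    pose proof (sin_term_nonneg v r (proj1 Hr)). pose proof (f_term_nonneg alpha f v r). nra. }
  set (V := potential_density n alpha f r v) in *.
  assert (Hsq : forall x, Rabs x <= M -> 0 <= x ^ 2 <= M ^ 2).
  { intros x Hx. split; [apply pow2_ge_0|]. rewrite <- pow2_abs. apply pow_incr.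
    split; [apply Rabs_pos|exact Hx]. }
  assert (Hpr : forall x y, Rabs x <= M -> Rabs y <= M -> Rabs (x * y) <= M ^ 2).
  { intros x y Hx Hy. rewrite Rabs_mult. simpl. rewrite Rmult_1_r.
    apply Rmult_le_compat; auto using Rabs_pos. }
  pose proof (Hsq a Hut) as Ha2. pose proof (Hsq b Hur) as Hb2.
  pose proof (Hpr a b Hut Hur) as Hab. pose proof (Hpr v a Hu Hut) as Hva.
  pose proof (Hpr v b Hu Hur) as Hvb.
  assert (Hw : 0 <= r ^ (n - 1) <= eps).
  { split; [apply pow_le; lra|]. apply Rle_trans with r; [|lra].
    apply pow_le_base; [lra|]. pose proof (wave_n H). lia. }
  assert (HABt : Rabs (A * t + B) <= Rabs A + Rabs B).
  { apply Rle_trans with (1 := Rabs_triang _ _). rewrite Rabs_mult, (Rabs_pos_eq t) by lra. nra. }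
  assert (Hgen : forall x y, Rabs x <= P0 -> Rabs y <= P0 + N * M ^ 2 ->
    Rabs (r ^ (n - 1) * ((A * t + B) * x + A * y))
    <= eps * ((Rabs A + Rabs B) * P0 + Rabs A * (P0 + N * M ^ 2))).
  { intros x y Hx Hy. rewrite Rabs_mult, (Rabs_pos_eq (r ^ (n - 1))) by lra.
    apply Rmult_le_compat; [lra|apply Rabs_pos|lra|].
    apply Rle_trans with (1 := Rabs_triang _ _). rewrite !Rabs_mult.
    apply Rplus_le_compat; apply Rmult_le_compat; auto using Rabs_pos; lra. }
  assert (HMM : 0 <= N * M) by nra.
  assert (HNM : 0 <= N * M ^ 2) by (apply Rmult_le_pos; [lra|apply pow2_ge_0]).
  assert (Hrs : forall z c, Rabs z <= c -> Rabs (r * z) <= c).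
  { intros z c Hz. rewrite Rabs_mult, (Rabs_pos_eq r) by lra. pose proof (Rabs_pos z). nra. }
  assert (Hmz : forall z, Rabs z <= M ^ 2 -> Rabs (N / 2 * z) <= N * M ^ 2).
  { intros z Hz. rewrite Rabs_mult, (Rabs_pos_eq (N / 2)) by lra. pose proof (Rabs_pos z). nra. }
  assert (BP : Rabs (mul_density n alpha f A B t r v a b)
    <= eps * ((Rabs A + Rabs B) * P0 + Rabs A * (P0 + N * M ^ 2))).
  { unfold mul_density. fold V N. apply Hgen.
    - rewrite Rabs_pos_eq; unfold P0; lra.
    - replace (r * a * b + N / 2 * v * a) with (r * (a * b) + N / 2 * (v * a)) by ring.
      apply Rle_trans with (1 := Rabs_triang _ _). pose proof (Hrs _ _ Hab). pose proof (Hmz _ Hva).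
      unfold P0. lra. }
  assert (BR : Rabs (mul_flux n alpha f A B t r v a b)
    <= eps * ((Rabs A + Rabs B) * P0 + Rabs A * (P0 + N * M ^ 2))).
  { unfold mul_flux. fold V N. apply Hgen.
    - apply Rle_trans with (1 := Hab). unfold P0. lra.
    - replace (N / 2 * v * b) with (N / 2 * (v * b)) by ring.
      apply Rle_trans with (1 := Rabs_triang _ _). pose proof (Hmz _ Hvb).
      assert (Rabs (/ 2 * (a ^ 2 + b ^ 2) - V) <= P0) by (apply Rabs_le; unfold P0; lra).
      pose proof (Hrs _ _ H1). lra. }
  apply Rle_trans with (1 := Rabs_triang _ _). rewrite Rabs_mult, (Rabs_pos_eq eps) by lra.
  pose proof (Rabs_pos (mul_density n alpha f A B t r v a b)).
  unfold C. nra.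
Qed.

(** The energy truncated at r = eps t grows by the nonnegative flux through the
    cone, up to O(eps) lost at the axis; then eps tends to 0. *)
Lemma energy_monotone S T : 0 < S -> S <= T < T0 -> T <= 1 -> slice_energy S <= slice_energy T.
Proof.
  intros HS HT HT1. apply Rnot_lt_le. intros Hlt.
  set (eta := (slice_energy S - slice_energy T) / 3). assert (Heta : 0 < eta) by (unfold eta; lra).
  destruct (ray_flux_axis 0 1 S T HS ltac:(lra) HT1) as (C & d & HC & Hd & Hfl).
  destruct (ray_energy_approx S eta ltac:(lra) Heta) as (d' & Hd' & Hap).
  destruct (exists_pos_below (d :: d' / 2 :: eta / C :: nil)) as (eps & He0 & He).
  { repeat constructor; try lra. apply Rdiv_lt_0_compat; lra. }
  rewrite !List.Forall_cons_iff in He. destruct He as (He1 & He2 & He3 & _).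
  specialize (Hap eps ltac:(lra) ltac:(lra)).
  pose proof (ray_energy_le eps T ltac:(lra) ltac:(lra)) as HleT.
  assert (Hm : - ray_energy eps T - - ray_energy eps S <= C * eps * (T - S)).
  { apply (increment_le (fun t => - ray_energy eps t) (fun t => - (ray_flux n alpha f 0 1 u t 1
      - ray_flux n alpha f 0 1 u t eps - RInt (ray_source n alpha f 0 u t) eps 1))); [lra| |].
    - intros t Ht. apply (is_derive_opp (ray_energy eps)). apply (is_derive_ray_integral H); lra.
    - intros t Ht. rewrite (RInt_ext _ (fun _ => 0)).
      2: { intros s _. change (ray_source n alpha f 0 u t s = 0). unfold ray_source, mul_source. ring. }
      rewrite RInt_const. unfold scal; simpl; unfold mult; simpl.
      pose proof (Hfl t eps Ht ltac:(lra)) as Hf. apply Rabs_le_between in Hf.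
      assert (0 <= ray_flux n alpha f 0 1 u t 1); [|lra].
      unfold ray_flux. rewrite !Rmult_1_r, Rmult_1_l.
      apply (cone_flux_energy n alpha f t t _ _ _ (wave_INR_n H)); lra. }
  assert (C * eps * (T - S) <= eta).
  { apply Rle_trans with (C * (eta / C) * 1); [|apply Req_le; field; lra].
    apply Rmult_le_compat; [nra|lra|nra|lra]. }
  unfold eta in *. lra.
Qed.

Lemma dominated_truncated_le (g : R -> R) k t a : 0 < t <= T0 -> 0 <= k ->
  (forall r, 0 < r <= t -> continuous g r) ->
  (forall r, 0 < r <= t -> g r <= k * radial n (energy_density n alpha f u) t r) ->
  0 < a <= t -> RInt g a t <= k * slice_energy t.
Proof.
  intros Ht Hk Hc Hg Ha.
  set (e := radial n (energy_density n alpha f u) t).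
  assert (He : ex_RInt e a t).
  { apply ex_RInt_cont; [lra|]. intros r Hr. apply energy_continuous; lra. }
  apply Rle_trans with (RInt (fun r => scal k (e r)) a t).
  - apply RInt_le; [lra| | |].
    + apply ex_RInt_cont; [lra|]. intros r Hr. apply Hc. lra.
    + apply (ex_RInt_scal (V := R_NormedModule)), He.
    + intros r Hr. apply Hg. lra.
  - apply Rle_trans with (k * RInt e a t).
    { apply Req_le, (RInt_scal (V := R_CompleteNormedModule) e a t k He). }
    apply Rmult_le_compat_l; [exact Hk|]. apply energy_truncated_le; assumption.
Qed.

Lemma radial_derivative_truncated_le t a : 0 < t <= T0 -> 0 < a <= t ->
  RInt (radial n (fun t r => d_r u t r ^ 2) t) a t <= 2 * slice_energy t.
Proof.
  intros Ht Ha. apply dominated_truncated_le; try lra.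
  - apply radial_derivative_continuous, Ht.
  - intros r Hr. unfold radial. rewrite <- Rmult_assoc.
    apply Rmult_le_compat_r; [apply pow_le; lra|].
    pose proof (energy_density_lower t r ltac:(lra)).
    pose proof (sin_term_nonneg (u t r) r ltac:(lra)). pose proof (f_term_nonneg alpha f (u t r) r).
    pose proof (pow2_ge_0 (d_t u t r)). lra.
Qed.

Lemma potential_truncated_le t a : 0 < t <= T0 -> 0 < a <= t ->
  RInt (radial n (fun t r => f (u t r) ^ 2 / Rpower r alpha) t) a t <= 2 * slice_energy t.
Proof.
  intros Ht Ha. apply dominated_truncated_le; try lra.
  - apply potential_continuous, Ht.
  - intros r Hr. unfold radial. rewrite <- Rmult_assoc.
    apply Rmult_le_compat_r; [apply pow_le; lra|].
    pose proof (energy_density_lower t r ltac:(lra)).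
    pose proof (sin_term_nonneg (u t r) r ltac:(lra)).
    pose proof (pow2_ge_0 (d_t u t r)). pose proof (pow2_ge_0 (d_r u t r)). lra.
Qed.

End Energy.


(** * Decay of the energy-type integral *)

Lemma sqrt_1_sqr_le (x : R) : sqrt (1 + x ^ 2) <= 1 + Rabs x.
Proof.
  pose proof (Rabs_pos x). rewrite <- (sqrt_Rsqr (1 + Rabs x)) by lra.
  apply sqrt_le_1_alt. unfold Rsqr. rewrite <- (pow2_abs x). nra.
Qed.

Section Main.
Context {n : nat} {alpha : R} {f : R -> R} {T0 : R} {u : R -> R -> R} {U : R * R -> Prop}.
Context (H : wave n alpha f T0 u U).

Let kinetic := radial n (fun t r => d_r u t r ^ 2).
Let potential := radial n (fun t r => f (u t r) ^ 2 / Rpower r alpha).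

(** The fundamental theorem of calculus for sqrt(1 + u^2) in r, started near the
    axis. The parameter lam is free so that the estimate gives boundedness when
    A and B are of the same size, and smallness when only B is small. *)
Lemma height_from_energy (c lam A B t : R) :
  0 < c -> (forall x, c ^ 2 * x ^ 2 <= f x ^ 2 * (1 + x ^ 2)) ->
  0 < lam -> 0 < t <= T0 -> t <= 1 ->
  (forall a, 0 < a <= t -> RInt (kinetic t) a t <= A) ->
  (forall a, 0 < a <= t -> RInt (potential t) a t <= B) ->
  forall r, 0 < r <= t -> sqrt (1 + u t r ^ 2) - 1 <= (lam * A + B / lam) / (2 * c).
Proof.
  intros Hc Hf Hl Ht Ht1 HA HB r Hr.
  set (psi := fun r => sqrt (1 + u t r ^ 2)).
  set (psi' := fun r => u t r * d_r u t r / psi r).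
  set (h := fun r => / (2 * c) * (lam * kinetic t r + / lam * potential t r)).
  pose proof (wave_field H) as F.
  assert (Hck : forall r, 0 < r <= t -> continuous (kinetic t) r).
  { intros rho Hrho. apply (radial_derivative_continuous H); assumption. }
  assert (Hcp : forall r, 0 < r <= t -> continuous (potential t) r).
  { intros rho Hrho. apply (potential_continuous H); assumption. }
  assert (Hk0 : forall r, 0 < r -> 0 <= kinetic t r).
  { intros rho Hrho. apply Rmult_le_pos; [apply pow2_ge_0|apply pow_le; lra]. }
  assert (Hp0 : forall r, 0 < r -> 0 <= potential t r).
  { intros rho Hrho. apply Rmult_le_pos; [apply f_term_nonneg|apply pow_le; lra]. }
  assert (Hpos : forall x, 0 < 1 + x ^ 2) by (intros x; pose proof (pow2_ge_0 x); lra).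
  assert (Hpsi : forall r, 0 < psi r) by (intros rho; apply sqrt_lt_R0, Hpos).
  assert (Hd : forall r, 0 < r <= t -> is_derive psi r (psi' r)).
  { intros rho Hrho. pose proof (wave_dom H _ (Omega_slice t rho Ht Hrho)) as HU.
    assert (Du : is_derive (u t) rho (d_r u t rho)).
    { evar_last. { apply (is_derive_comp_2d u (fun _ => t) (fun y => y) rho _ _ 0 1 (C2_u F HU));
        auto_derive; auto. } simpl. ring. }
    unfold psi, psi'. set (g := u t) in *. change (psi rho) with (sqrt (1 + g rho ^ 2)).
    auto_derive.
    - split; [exists (d_r u t rho); exact Du|split; auto]. apply (Hpos (g rho)).
    - rewrite (Derive_eta _ _ _ Du). simpl.
      pose proof (sqrt_lt_R0 _ (Hpos (g rho))) as Hs. simpl in Hs. field. lra. }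
  assert (Hcd : forall r, 0 < r <= t -> continuous psi' r).
  { intros rho Hrho. destruct (field_continuity H t rho (Omega_slice t rho Ht Hrho)) as (Cu & _ & Cr & _).
    apply (continuity_2d_section (fun t' r' => u t' r' * d_r u t' r' / sqrt (1 + u t' r' ^ 2))).
    unfold Rdiv. apply continuity_2d_pt_mult; [continuity_2d|]. apply continuity_2d_pt_inv.
    - apply (continuity_1d_2d_pt_comp sqrt); [|continuity_2d].
      apply continuity_pt_sqrt. left. apply Hpos.
    - apply Rgt_not_eq, Hpsi. }
  assert (Hch : forall r, 0 < r <= t -> continuous h r).
  { intros rho Hrho. unfold h.
    apply (continuous_scal_r (/ (2 * c)) (fun y => lam * kinetic t y + / lam * potential t y)).
    apply (continuous_plus (fun y => lam * kinetic t y) (fun y => / lam * potential t y)).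
    - apply (continuous_scal_r lam (kinetic t)), Hck, Hrho.
    - apply (continuous_scal_r (/ lam) (potential t)), Hcp, Hrho. }
  assert (Hle : forall r, 0 < r <= t -> psi' r <= h r).
  { intros rho Hrho. unfold psi', h, kinetic, potential, radial.
    set (v := u t rho). set (b := d_r u t rho). set (w := rho ^ (n - 1)).
    assert (Hw : 0 < w) by (apply pow_lt; lra).
    pose proof (Rpower_pos rho alpha) as HE. set (E := Rpower rho alpha) in *.
    (* This is where 2 (n - 1) <= alpha is used. *)
    assert (HwE : E <= w * w).
    { unfold E, w. rewrite <- pow_add. apply Rpower_le_pow; [lra|].
      rewrite plus_INR, INR_pred by apply (wave_n H).
      pose proof (wave_alpha1 H). lra. }
    set (p := psi rho). assert (Hp : 0 < p) by apply Hpsi.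
    assert (Hp2 : p * p = 1 + v ^ 2) by (unfold p, psi; apply sqrt_sqrt; left; apply Hpos).
    assert (Hvp : c * Rabs v <= Rabs (f v) * p).
    { rewrite <- (Rabs_pos_eq c), <- (Rabs_pos_eq p), <- !Rabs_mult by lra.
      apply Rabs_le_of_pow2; [apply Rabs_pos|]. rewrite pow2_abs.
      pose proof (Hf v). replace ((f v * p) ^ 2) with (f v ^ 2 * (p * p)) by ring.
      rewrite Hp2. lra. }
    assert (Hfb : Rabs (f v) * Rabs b * 2 <= lam * (b ^ 2 * w) + / lam * (f v ^ 2 / E * w)).
    { assert (HfE : f v ^ 2 * / w <= f v ^ 2 / E * w).
      { unfold Rdiv. rewrite Rmult_assoc. apply Rmult_le_compat_l; [apply pow2_ge_0|].
        apply Rmult_le_reg_l with (w * E); [nra|].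
        replace (w * E * / w) with E by (field; lra).
        replace (w * E * (/ E * w)) with (w * w) by (field; lra). exact HwE. }
      assert (/ lam * (f v ^ 2 * / w) <= / lam * (f v ^ 2 / E * w)).
      { apply Rmult_le_compat_l; [left; apply Rinv_0_lt_compat, Hl|exact HfE]. }
      assert (Rabs (f v) * Rabs b * 2 <= lam * (b ^ 2 * w) + / lam * (f v ^ 2 * / w)); [|lra].
      rewrite <- (pow2_abs b), <- (pow2_abs (f v)).
      set (x := Rabs b). set (y := Rabs (f v)).
      replace (lam * (x ^ 2 * w) + / lam * (y ^ 2 * / w))
        with (y * x * 2 + (lam * w * x - y) ^ 2 / (lam * w)) by (field; lra).
      assert (0 <= (lam * w * x - y) ^ 2 / (lam * w)); [|lra].
      apply Rmult_le_pos; [apply pow2_ge_0|]. left. apply Rinv_0_lt_compat. nra. }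
    apply Rle_trans with (Rabs (f v) * Rabs b / c).
    - apply Rle_div_l; [exact Hp|]. apply Rle_trans with (1 := Rle_abs _).
      rewrite Rabs_mult. apply Rmult_le_reg_l with c; [exact Hc|].
      replace (c * (Rabs (f v) * Rabs b / c * p)) with (Rabs (f v) * p * Rabs b) by (field; lra).
      rewrite <- Rmult_assoc. apply Rmult_le_compat_r; [apply Rabs_pos|exact Hvp].
    - replace (Rabs (f v) * Rabs b / c) with (/ (2 * c) * (Rabs (f v) * Rabs b * 2)) by (field; lra).
      apply Rmult_le_compat_l; [left; apply Rinv_0_lt_compat; lra|exact Hfb]. }
  assert (Hint : forall e, 0 < e <= r -> psi r - psi e <= (lam * A + B / lam) / (2 * c)).
  { intros e He.
    assert (Hex : forall g : R -> R, (forall r, 0 < r <= t -> continuous g r) ->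
      forall x y, 0 < x <= y -> y <= t -> ex_RInt g x y).
    { intros g Hg x y Hx Hy. apply ex_RInt_cont; [lra|]. intros z Hz. apply Hg. lra. }
    assert (Hi : is_RInt psi' e r (psi r - psi e)).
    { apply (is_RInt_derive (V := R_CompleteNormedModule) psi psi').
      - intros z Hz. rewrite Rmin_left, Rmax_right in Hz by lra. apply Hd. lra.
      - intros z Hz. rewrite Rmin_left, Rmax_right in Hz by lra. apply Hcd. lra. }
    apply (is_RInt_unique (V := R_CompleteNormedModule)) in Hi. rewrite <- Hi.
    apply Rle_trans with (RInt h e r).
    { apply RInt_le; [lra|apply Hex; [exact Hcd|lra|lra]|apply Hex; [exact Hch|lra|lra]|].
      intros z Hz. apply Hle. lra. }
    apply Rle_trans with (RInt h e t).
    { rewrite <- (RInt_Chasles h e r t) by (apply Hex; [exact Hch|lra|lra]).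
      change (RInt h e r <= RInt h e r + RInt h r t).
      assert (0 <= RInt h r t); [|lra].
      apply RInt_ge_0; [lra|apply Hex; [exact Hch|lra|lra]|]. intros z Hz. unfold h.
      pose proof (Hk0 z ltac:(lra)). pose proof (Hp0 z ltac:(lra)).
      assert (0 < / lam) by (apply Rinv_0_lt_compat, Hl).
      apply Rmult_le_pos; [left; apply Rinv_0_lt_compat; lra|]. nra. }
    assert (Hh : RInt h e t = / (2 * c) * (lam * RInt (kinetic t) e t + / lam * RInt (potential t) e t)).
    { apply (is_RInt_unique (V := R_CompleteNormedModule)). unfold h.
      apply (is_RInt_scal (V := R_NormedModule) (fun y => lam * kinetic t y + / lam * potential t y)).
      apply (is_RInt_plus (V := R_NormedModule) (fun y => lam * kinetic t y) (fun y => / lam * potential t y)).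
      - apply (is_RInt_scal (V := R_NormedModule) (kinetic t)).
        apply (RInt_correct (V := R_CompleteNormedModule)), Hex; [exact Hck|lra|lra].
      - apply (is_RInt_scal (V := R_NormedModule) (potential t)).
        apply (RInt_correct (V := R_CompleteNormedModule)), Hex; [exact Hcp|lra|lra]. }
    rewrite Hh. unfold Rdiv. rewrite Rmult_comm.
    apply Rmult_le_compat_r; [left; apply Rinv_0_lt_compat; lra|].
    pose proof (HA e ltac:(lra)). pose proof (HB e ltac:(lra)).
    assert (0 < / lam) by (apply Rinv_0_lt_compat, Hl). nra. }
  apply Rnot_lt_le. intros Hlt.
  set (eta := sqrt (1 + u t r ^ 2) - 1 - (lam * A + B / lam) / (2 * c)) in *.
  assert (Heta : 0 < eta) by (unfold eta; lra).
  destruct (field_continuity H t 0 ltac:(unfold Omega; simpl; lra)) as (Cu & _).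
  destruct (Cu (mkposreal eta Heta)) as [d Hdd]. simpl in Hdd.
  assert (Hm : 0 < Rmin (d / 2) r) by (apply Rmin_pos; [pose proof (cond_pos d)|]; lra).
  pose proof (Rmin_l (d / 2) r) as M1. pose proof (Rmin_r (d / 2) r) as M2.
  set (e := Rmin (d / 2) r) in *. pose proof (cond_pos d).
  specialize (Hdd t e). rewrite Rminus_diag, Rabs_R0, Rminus_0_r, (Rabs_pos_eq e) in Hdd by lra.
  specialize (Hdd ltac:(lra) ltac:(lra)).
  rewrite (wave_axis H t Ht), Rminus_0_r in Hdd.
  pose proof (sqrt_1_sqr_le (u t e)). pose proof (Hint e ltac:(lra)). unfold psi in *.
  unfold eta in Hdd. lra.
Qed.


Notation En := (@slice_energy n alpha f u).
Notation RE := (@ray_energy n alpha f u).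

(** On a bounded range of heights the factor 1 + x^2 of [growth_lower_bound] is a
    constant, and the range is bounded by the energy at time T1. *)
Lemma height_bound T1 : 0 < T1 < T0 -> T1 <= 1 ->
  exists K, 0 < K /\ forall t r, 0 < t <= T1 -> 0 < r <= t -> u t r ^ 2 <= K * f (u t r) ^ 2.
Proof.
  intros HT HT1.
  destruct (growth_lower_bound f (wave_df H) (wave_df_cont H)
    (wave_f0 H) (wave_df0 H) (wave_mono H)) as (c & Hc & Hf).
  pose proof (slice_energy_nonneg H T1 ltac:(lra)) as HE.
  (* L bounds sqrt (1 + u^2), by the height estimate with lam = 1. *)
  set (L := 1 + 2 * En T1 / c).
  assert (HL : 1 <= L).
  { unfold L. assert (0 <= 2 * En T1 / c); [|lra].
    apply Rmult_le_pos; [lra|left; apply Rinv_0_lt_compat, Hc]. }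
  exists (L ^ 2 / c ^ 2). split.
  { apply Rdiv_lt_0_compat; apply pow_lt; lra. }
  intros t r Ht Hr.
  pose proof (energy_monotone H t T1 ltac:(lra) ltac:(lra) HT1) as Hmon.
  pose proof (height_from_energy c 1 (2 * En T1) (2 * En T1) t Hc Hf Rlt_0_1 ltac:(lra) ltac:(lra)) as Hs.
  assert (Hs' : sqrt (1 + u t r ^ 2) <= L).
  { assert (sqrt (1 + u t r ^ 2) - 1 <= (1 * (2 * En T1) + 2 * En T1 / 1) / (2 * c)).
    { apply Hs; [| |exact Hr].
      - intros a Ha. apply Rle_trans with (1 := radial_derivative_truncated_le H t a ltac:(lra) Ha). lra.
      - intros a Ha. apply Rle_trans with (1 := potential_truncated_le H t a ltac:(lra) Ha). lra. }
    replace ((1 * (2 * En T1) + 2 * En T1 / 1) / (2 * c)) with (2 * En T1 / c) in * by (field; lra).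
    unfold L. lra. }
  pose proof (pow2_ge_0 (u t r)).
  pose proof (sqrt_sqrt (1 + u t r ^ 2) ltac:(lra)) as Hss.
  pose proof (sqrt_pos (1 + u t r ^ 2)).
  assert (H2 : 1 + u t r ^ 2 <= L ^ 2) by nra.
  pose proof (Hf (u t r)) as Hfu. pose proof (pow2_ge_0 (f (u t r))).
  assert (Hc2 : 0 < c ^ 2) by (apply pow_lt, Hc).
  apply Rmult_le_reg_l with (c ^ 2); [exact Hc2|].
  replace (c ^ 2 * (L ^ 2 / c ^ 2 * f (u t r) ^ 2)) with (f (u t r) ^ 2 * L ^ 2) by (field; lra).
  apply Rle_trans with (1 := Hfu). apply Rmult_le_compat_l; assumption.
Qed.

Lemma RInt_ray_le (g h : R -> R) eps : 0 < eps <= 1 ->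
  (forall s, 0 < s <= 1 -> continuous g s) -> (forall s, 0 < s <= 1 -> continuous h s) ->
  (forall s, 0 < s <= 1 -> g s <= h s) -> RInt g eps 1 <= RInt h eps 1.
Proof.
  intros He Hg Hh Hle. apply RInt_le; [lra| | |].
  - apply ex_RInt_cont; [lra|]. intros s Hs. apply Hg. lra.
  - apply ex_RInt_cont; [lra|]. intros s Hs. apply Hh. lra.
  - intros s Hs. apply Hle. lra.
Qed.

(** The functional is the integral of the density for A = 1, B = - C1 T, that is,
    the scaling functional minus C1 T times the energy. On [S, T] its derivative
    is at most the source plus the flux at the inner edge s = eps, since the flux
    through the cone is then nonpositive ([cone_flux_morawetz]). *)
Lemma morawetz_truncated (T1 K S T : R) :
  0 < T1 < T0 -> T1 <= 1 -> 0 < K ->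
  (forall t r, 0 < t <= T1 -> 0 < r <= t -> u t r ^ 2 <= K * f (u t r) ^ 2) ->
  0 < S <= T -> T <= T1 ->
  let m := (INR n - 1) / 2 in
  exists Cf d, 0 < Cf /\ 0 < d <= 1 /\ forall eps, 0 < eps <= d ->
    T / 4 * RInt (fun s => T * radial n (decaying_density alpha f u) T (T * s)) eps 1
      <= m * (1 + K) * (T * sqrt T) * En T1 + (2 + m * (1 + K)) * S * En T1
         + (2 + m + m * K) * T * (RE eps T - RE eps S)
         + T * (8 * m ^ 2 * K * T * En T1 + Cf * eps).
Proof.
  intros HT1 HT11 HK Hh HS HT m.
  pose proof (wave_INR_n H) as Hn. pose proof (wave_alpha3 H) as Ha.
  pose proof (slice_energy_nonneg H T1 ltac:(lra)) as HE0. set (E0 := En T1) in *.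
  assert (Hm : 0 < m) by (unfold m; lra).
  set (C1 := 2 + m + m * K). set (C2 := 2 + m * (1 + K)). set (C3 := 8 * m ^ 2 * K).
  assert (HmK : 0 < m * K) by nra.
  assert (HC3 : 0 < C3) by (unfold C3; pose proof (pow_lt m 2 Hm); nra).
  assert (HC1 : 0 < C1) by (unfold C1; lra). assert (HC2 : 0 < C2) by (unfold C2; nra).
  assert (HEt : forall t, 0 < t <= T1 -> En t <= E0).
  { intros t Ht. apply (energy_monotone H); lra. }
  set (G := radial n (decaying_density alpha f u) T).
  assert (HGc : forall r, 0 < r <= T -> continuous G r).
  { intros r Hr. apply (decaying_continuous H); lra. }
  pose proof (sqrt_lt_R0 T ltac:(lra)) as Hq. pose proof (sqrt_sqrt T ltac:(lra)) as Hqq.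
  set (q := sqrt T) in *.
  destruct (ray_flux_axis H 1 (- (C1 * T)) S T ltac:(lra) ltac:(lra) ltac:(lra))
    as (Cf & d & HCf & Hd & Hfl).
  exists Cf, d. split; [exact HCf|]. split; [exact Hd|]. intros eps He.
  set (B := - (C1 * T)) in *.
  set (Hf := fun t => RInt (ray_density n alpha f 1 B u t) eps 1).
  set (re := fun t => RE eps t).
  assert (Hre : forall t, 0 < t <= T -> 0 <= re t <= E0).
  { intros t Ht. split.
    - apply RInt_ge_0; [lra|apply (ex_RInt_ray H); lra|].
      intros s Hs. apply (ray_density_energy_nonneg H); lra.
    - apply Rle_trans with (1 := ray_energy_le H eps t ltac:(lra) ltac:(lra)). apply HEt. lra. }
  assert (Hrc : forall A B t s, 0 < t <= T -> 0 < s <= 1 -> continuous (ray_density n alpha f A B u t) s).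
  { intros A' B' t s Ht Hs. apply (ray_continuous H); lra. }
  assert (Hscal : forall k t, 0 < t <= T ->
    RInt (fun s => k * ray_density n alpha f 0 1 u t s) eps 1 = k * re t).
  { intros k t Ht. apply (RInt_scal (V := R_CompleteNormedModule) (ray_density n alpha f 0 1 u t)).
    apply (ex_RInt_ray H); lra. }
  assert (Hkc : forall k t s, 0 < t <= T -> 0 < s <= 1 ->
    continuous (fun s => k * ray_density n alpha f 0 1 u t s) s).
  { intros k t s Ht Hs. apply (continuous_scal_r (V := R_NormedModule) k), Hrc; lra. }
  assert (Hgrow : Hf T - Hf S <= (C3 * T * E0 + Cf * eps) * (T - S)).
  { apply (increment_le Hf (fun t => ray_flux n alpha f 1 B u t 1 - ray_flux n alpha f 1 B u t eps
      - RInt (ray_source n alpha f 1 u t) eps 1)); [lra| |].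
    - intros t Ht. apply (is_derive_ray_integral H); lra.
    - intros t Ht.
      pose proof (Hfl t eps Ht ltac:(lra)) as Hfe. apply Rabs_le_between in Hfe.
      assert (Hf1 : ray_flux n alpha f 1 B u t 1 <= 0).
      { unfold ray_flux. rewrite !Rmult_1_r, Rmult_1_l.
        apply (cone_flux_morawetz n alpha f K t t); try lra.
        - apply Hh; lra.
        - fold m. fold C1. apply Rmult_le_compat_l; lra. }
      assert (Hsrc : - RInt (ray_source n alpha f 1 u t) eps 1 <= C3 * t * re t).
      { rewrite <- Hscal by lra.
        rewrite <- (RInt_opp (V := R_CompleteNormedModule)).
        - apply RInt_ray_le; [lra| | |].
          + intros s Hs. apply (continuous_opp (V := R_NormedModule)).
            apply continuity_2d_section, (continuity_ray_source H), (near_ray_of_Omega H); lra.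
          + intros s Hs. apply Hkc; lra.
          + intros s Hs. change (- ray_source n alpha f 1 u t s <= C3 * t * ray_density n alpha f 0 1 u t s).
            unfold ray_source, ray_density.
            pose proof (mul_source_lower n alpha f K t (t * s) (u t (t * s)) (d_t u t (t * s)) (d_r u t (t * s))
              Hn Ha ltac:(nra) ltac:(lra) HK ltac:(apply Hh; nra) (wave_mono H _)
              (wave_alpha2 H)) as HQ. fold m in HQ. fold C3 in HQ.
            set (Q := mul_source n alpha f 1 (t * s) (u t (t * s))) in *.
            set (P := mul_density n alpha f 0 1 t (t * s) (u t (t * s))
              (d_t u t (t * s)) (d_r u t (t * s))) in *.
            replace (C3 * t * (t * P)) with (t * (C3 * t * P)) by ring.
            rewrite Ropp_mult_distr_r. apply Rmult_le_compat_l; lra.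
        - apply ex_RInt_cont; [lra|]. intros s Hs.
          apply continuity_2d_section, (continuity_ray_source H), (near_ray_of_Omega H); lra. }
      assert (C3 * t * re t <= C3 * T * E0).
      { pose proof (Hre t ltac:(lra)).
        apply Rmult_le_compat; [nra|lra|apply Rmult_le_compat_l; lra|lra]. }
      lra. }
  assert (Hlow : T / 4 * RInt (fun s => T * G (T * s)) eps 1 + (B - m * (1 + K) * (T * q)) * re T <= Hf T).
  { assert (HGr : forall s, 0 < s <= 1 -> continuous (fun s => T * G (T * s)) s).
    { intros s Hs. apply (continuous_scal_r (V := R_NormedModule) T (fun s => G (T * s))).
      apply (continuous_comp (fun s => T * s) G); [|apply HGc; nra].
      apply (continuous_scal_r (V := R_NormedModule) T (fun s => s)), continuous_id. }
    rewrite <- Hscal by lra.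
    apply Rle_trans with (RInt (fun s => T / 4 * (T * G (T * s))
       + (B - m * (1 + K) * (T * q)) * ray_density n alpha f 0 1 u T s) eps 1).
    - apply Req_le. symmetry. apply (is_RInt_unique (V := R_CompleteNormedModule)).
      apply (is_RInt_plus (V := R_NormedModule)).
      + apply (is_RInt_scal (V := R_NormedModule)), (RInt_correct (V := R_CompleteNormedModule)).
        apply ex_RInt_cont; [lra|]. intros s Hs. apply HGr. lra.
      + apply (RInt_correct (V := R_CompleteNormedModule)).
        apply ex_RInt_cont; [lra|]. intros s Hs. apply Hkc; lra.
    - apply RInt_ray_le; [lra| | |].
      + intros s Hs. apply (continuous_plus (V := R_NormedModule) (fun s => T / 4 * (T * G (T * s)))).
        * apply (continuous_scal_r (V := R_NormedModule) (T / 4)), HGr, Hs.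
        * apply Hkc; lra.
      + intros s Hs. apply Hrc; lra.
      + intros s Hs. unfold G, radial, decaying_density, ray_density.
        set (r := T * s). assert (Hr : 0 < r <= T) by (unfold r; nra).
        set (v := u T r). set (a := d_t u T r). set (b := d_r u T r).
        pose proof (mul_density_lower n alpha f K T r v a b Hn Ha Hr ltac:(lra) HK
          ltac:(apply Hh; lra) B q Hq Hqq) as HP. fold m in HP.
        set (P := mul_density n alpha f 0 1 T r v a b) in *.
        set (P1 := mul_density n alpha f 1 B T r v a b) in *.
        set (D := (1 - r / T) * (a - b) ^ 2 + (a + b) ^ 2 + sin v ^ 2 / r ^ 2 + f v ^ 2 / Rpower r alpha) in *.
        replace (T / 4 * (T * (D * r ^ (n - 1))) + (B - m * (1 + K) * (T * q)) * (T * P))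
          with (T * (T / 4 * (r ^ (n - 1) * D) + (B - m * (1 + K) * (T * q)) * P)) by ring.
        apply Rmult_le_compat_l; lra. }
  assert (Hup : Hf S <= (B + C2 * S) * re S).
  { rewrite <- Hscal by lra. apply RInt_ray_le; [lra| | |].
    - intros s Hs. apply Hrc; lra.
    - intros s Hs. apply Hkc; lra.
    - intros s Hs. unfold ray_density. set (r := S * s).
      assert (Hr : 0 < r <= S) by (unfold r; nra).
      pose proof (mul_density_upper n alpha f K S r (u S r) (d_t u S r) (d_r u S r) Hn Ha Hr ltac:(lra) HK
          ltac:(apply Hh; lra) B (sqrt S) (sqrt_lt_R0 S ltac:(lra)) (sqrt_sqrt S ltac:(lra))) as HP.
      fold m in HP. fold C2 in HP.
      set (P := mul_density n alpha f 0 1 S r (u S r) (d_t u S r) (d_r u S r)) in *.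
      replace ((B + C2 * S) * (S * P)) with (S * ((B + C2 * S) * P)) by ring.
      apply Rmult_le_compat_l; lra. }
  pose proof (Hre T ltac:(lra)) as HreT. pose proof (Hre S ltac:(lra)) as HreS.
  assert (G1 : m * (1 + K) * (T * q) * re T <= m * (1 + K) * (T * q) * E0).
  { apply Rmult_le_compat_l; [|lra]. apply Rmult_le_pos; nra. }
  assert (G2 : C2 * S * re S <= C2 * S * E0) by (apply Rmult_le_compat_l; [nra|lra]).
  assert (G3 : (C3 * T * E0 + Cf * eps) * (T - S) <= (C3 * T * E0 + Cf * eps) * T).
  { apply Rmult_le_compat_l; [|lra].
    assert (0 <= C3 * T * E0) by (repeat apply Rmult_le_pos; lra). nra. }
  fold (re T) (re S). unfold B in *. lra.
Qed.

(** The inequality [morawetz_truncated] divided by T/4, with eps -> 0. *)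
Lemma morawetz_estimate T1 : 0 < T1 < T0 -> T1 <= 1 ->
  exists C, 0 < C /\ forall S T, 0 < S <= T -> T <= T1 -> forall a, 0 < a <= T ->
    RInt (radial n (decaying_density alpha f u) T) a T
      <= C * (En T - En S + S / T + sqrt T).
Proof.
  intros HT1 HT11. destruct (height_bound T1 HT1 HT11) as (K & HK & Hh).
  pose proof (wave_INR_n H) as Hn. pose proof (wave_alpha3 H) as Ha.
  pose proof (slice_energy_nonneg H T1 ltac:(lra)) as HE0. set (E0 := En T1) in *.
  set (m := (INR n - 1) / 2). assert (Hm : 0 < m) by (unfold m; lra).
  set (C1 := 2 + m + m * K). set (C2 := 2 + m * (1 + K)). set (C3 := 8 * m ^ 2 * K).
  assert (HmK : 0 < m * K) by nra.
  assert (HC3 : 0 < C3) by (unfold C3; pose proof (pow_lt m 2 Hm); nra).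
  assert (HC1 : 0 < C1) by (unfold C1; lra). assert (HC2 : 0 < C2) by (unfold C2; nra).
  set (C := 4 * (C1 + C2 * E0 + C3 * E0 + m * (1 + K) * E0)).
  assert (HmKE : 0 <= m * (1 + K) * E0) by (apply Rmult_le_pos; [nra|lra]).
  assert (HC2E : 0 <= C2 * E0) by (apply Rmult_le_pos; lra).
  assert (HC3E : 0 <= C3 * E0) by (apply Rmult_le_pos; lra).
  exists C. split; [unfold C; lra|]. intros S T HS HT a0 Ha0.
  pose proof (energy_monotone H S T ltac:(lra) ltac:(lra) ltac:(lra)) as HST.
  assert (HEt : forall t, 0 < t <= T1 -> En t <= E0).
  { intros t Ht. apply (energy_monotone H); lra. }
  set (G := radial n (decaying_density alpha f u) T).
  assert (HGc : forall r, 0 < r <= T -> continuous G r).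
  { intros r Hr. apply (decaying_continuous H); lra. }
  assert (HGp : forall r, 0 < r <= T -> 0 <= G r).
  { intros r Hr. apply (decaying_bounds H T r Hr). }
  pose proof (sqrt_lt_R0 T ltac:(lra)) as Hq. pose proof (sqrt_sqrt T ltac:(lra)) as Hqq.
  set (q := sqrt T) in *.
  destruct (morawetz_truncated T1 K S T HT1 HT11 HK Hh HS HT)
    as (Cf & d & HCf & Hd & Hcore).
  fold m E0 C1 C2 C3 q G in Hcore.
  apply Rnot_lt_le. intros Hlt.
  set (X := C * (En T - En S + S / T + q)) in *.
  set (eta := RInt G a0 T - X) in *. assert (Heta : 0 < eta) by (unfold eta; lra).
  assert (Heta' : 0 < eta / (8 * C1)) by (apply Rdiv_lt_0_compat; lra).
  destruct (ray_energy_approx H S (eta / (8 * C1)) ltac:(lra) Heta') as (d2 & Hd2 & Hap).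
  destruct (exists_pos_below (d :: a0 / T :: d2 / 2 :: eta / (16 * Cf) :: nil))
    as (eps & He0 & He).
  { repeat constructor; try lra; apply Rdiv_lt_0_compat; lra. }
  rewrite !List.Forall_cons_iff in He. destruct He as (He1 & He2 & He3 & He4 & _).
  specialize (Hcore eps ltac:(lra)). specialize (Hap eps ltac:(lra) ltac:(lra)).
  pose proof (ray_energy_le H eps T ltac:(lra) ltac:(lra)) as HeT.
  rewrite ray_rescale in Hcore; try lra; try assumption.
  assert (HTa : 0 < T * eps <= a0).
  { split; [nra|]. apply Rle_trans with (T * (a0 / T)); [apply Rmult_le_compat_l; lra|].
    apply Req_le. field. lra. }
  pose proof (RInt_mono_left G T (T * eps) a0 HGc HGp HTa ltac:(lra)) as Hmono.
  assert (E1 : C1 * (eta / (8 * C1)) = eta / 8) by (field; lra).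
  assert (E2 : Cf * eps <= eta / 16).
  { apply Rle_trans with (Cf * (eta / (16 * Cf))); [apply Rmult_le_compat_l; lra|].
    apply Req_le. field. lra. }
  assert (F1 : RInt G (T * eps) T <= 4 * (m * (1 + K) * q * E0 + C2 * (S / T) * E0
     + C1 * (En T - En S + eta / (8 * C1)) + (C3 * T * E0 + eta / 16))).
  { apply Rmult_le_reg_l with (T / 4); [lra|]. apply Rle_trans with (1 := Hcore).
    replace (T / 4 * (4 * (m * (1 + K) * q * E0 + C2 * (S / T) * E0 +
      C1 * (En T - En S + eta / (8 * C1)) + (C3 * T * E0 + eta / 16))))
     with (m * (1 + K) * (T * q) * E0 + C2 * S * E0
       + C1 * T * (En T - En S + eta / (8 * C1)) + T * (C3 * T * E0 + eta / 16)) by (field; lra).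
    assert (C1 * T * (RE eps T
      - RE eps S) <= C1 * T * (En T - En S + eta / (8 * C1))).
    { apply Rmult_le_compat_l; [nra|lra]. }
    assert (T * (C3 * T * E0 + Cf * eps) <= T * (C3 * T * E0 + eta / 16)).
    { apply Rmult_le_compat_l; lra. }
    lra. }
  assert (HTq : T <= q) by nra.
  assert (HST' : 0 <= S / T) by (apply Rmult_le_pos; [lra|left; apply Rinv_0_lt_compat; lra]).
  assert (F2 : C3 * T * E0 <= C3 * E0 * q).
  { replace (C3 * T * E0) with (C3 * E0 * T) by ring. apply Rmult_le_compat_l; assumption. }
  assert (P1 : 0 <= C1 * (S / T)) by (apply Rmult_le_pos; lra).
  assert (P2 : 0 <= C1 * q) by nra.
  assert (P3 : 0 <= C2 * E0 * (En T - En S)) by (apply Rmult_le_pos; lra).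
  assert (P4 : 0 <= C2 * E0 * q) by (apply Rmult_le_pos; lra).
  assert (P5 : 0 <= C3 * E0 * (En T - En S + S / T)) by (apply Rmult_le_pos; lra).
  assert (P6 : 0 <= m * (1 + K) * E0 * (En T - En S + S / T)) by (apply Rmult_le_pos; lra).
  unfold eta, X, C in *. lra.
Qed.

End Main.


(** * Conclusion *)

Section Conclusion.
Context {n : nat} {alpha : R} {f : R -> R} {T0 : R} {u : R -> R -> R} {U : R * R -> Prop}.
Context (H : wave n alpha f T0 u U).

Lemma decaying_integrable T : 0 < T <= T0 -> integrable_Sigma n (decaying_density alpha f u) T.
Proof.
  intros HT.
  destruct (improper_bounded (radial n (decaying_density alpha f u) T) T
              (4 * @slice_energy n alpha f u T)) as (l & Hl & _).
  - apply (decaying_continuous H), HT.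
  - intros r Hr. apply (decaying_bounds H T r Hr).
  - lra.
  - intros a Ha. apply (dominated_truncated_le H); try lra.
    + apply (decaying_continuous H), HT.
    + intros r Hr. apply (decaying_bounds H T r Hr).
  - exists l. exact Hl.
Qed.

(** E is monotone and nonnegative, so E(T) - E(S) is small for all S <= T near 0;
    S is taken to be a small fixed fraction of T, and T so small that its square
    root is small. *)
Lemma decaying_integral_small eta : 0 < T0 -> 0 < eta ->
  exists d, 0 < d /\ d < T0 /\ d <= 1 /\ forall T, 0 < T <= d -> forall a, 0 < a <= T ->
    RInt (radial n (decaying_density alpha f u) T) a T <= eta.
Proof.
  intros HT0 Heta.
  set (T1 := Rmin 1 (T0 / 2)).
  assert (HT1 : 0 < T1 /\ T1 <= 1 /\ T1 <= T0 / 2).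
  { unfold T1. split; [apply Rmin_pos; lra|]. split; [apply Rmin_l|apply Rmin_r]. }
  clearbody T1. destruct HT1 as (HT1 & HT11 & HT12).
  destruct (morawetz_estimate H T1 ltac:(lra) HT11) as (C & HC & HM).
  set (En := @slice_energy n alpha f u) in *.
  set (e := eta / (3 * C)). assert (He : 0 < e) by (apply Rdiv_lt_0_compat; lra).
  assert (HL : exists T2, 0 < T2 <= T1 /\ forall S, 0 < S <= T2 -> En T2 - En S <= e).
  { destruct (completeness (fun y => exists t, 0 < t <= T1 /\ y = - En t)) as [l [Hub Hlub]].
    - exists 0. intros y (t & Ht & ->). pose proof (slice_energy_nonneg H t ltac:(lra)). unfold En. lra.
    - exists (- En T1), T1. split; [lra|reflexivity].
    - assert (Hex : exists t, 0 < t <= T1 /\ l - e < - En t).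
      { apply Classical_Prop.NNPP. intros Hn.
        assert (l <= l - e); [|lra].
        apply Hlub. intros y (t & Ht & ->). apply Rnot_lt_le. intros Hlt.
        apply Hn. exists t. split; assumption. }
      destruct Hex as (T2 & HT2 & Hlt). exists T2. split; [exact HT2|].
      intros S HS. assert (- En S <= l); [|lra].
      apply Hub. exists S. split; [lra|reflexivity]. }
  destruct HL as (T2 & HT2 & HL).
  assert (Hm : 0 < Rmin T2 (e * e)) by (apply Rmin_pos; nra).
  pose proof (Rmin_l T2 (e * e)) as M1. pose proof (Rmin_r T2 (e * e)) as M2.
  exists (Rmin T2 (e * e)). split; [exact Hm|]. split; [lra|]. split; [lra|].
  intros T HT a Ha.
  (* S = k T; the second argument of the minimum keeps S <= T. *)
  set (k := Rmin e 1). assert (Hk : 0 < k) by (apply Rmin_pos; lra).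
  assert (Hk1 : k <= e) by apply Rmin_l. assert (Hk2 : k <= 1) by apply Rmin_r.
  apply Rle_trans with (1 := HM (k * T) T ltac:(nra) ltac:(lra) a Ha).
  assert (En T - En (k * T) <= e).
  { pose proof (HL (k * T) ltac:(nra)).
    assert (En T <= En T2) by (apply (energy_monotone H); lra). lra. }
  assert (sqrt T <= e).
  { rewrite <- (sqrt_square e) by lra. apply sqrt_le_1_alt. lra. }
  replace (k * T / T) with k by (field; lra).
  apply Rle_trans with (C * (3 * e)); [apply Rmult_le_compat_l; lra|].
  unfold e. apply Req_le. field. lra.
Qed.

Lemma int_Sigma_decaying_limit : 0 < T0 ->
  filterlim (fun T => int_Sigma n (decaying_density alpha f u) T) (at_right 0) (locally 0).
Proof.
  intros HT0 P [eps HP].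
  pose proof (cond_pos eps) as Heps. set (A := sphere_area (n - 1)).
  assert (Heta : 0 < eps / (2 * (Rabs A + 1))).
  { pose proof (Rabs_pos A). apply Rdiv_lt_0_compat; lra. }
  destruct (decaying_integral_small _ HT0 Heta) as (d & Hd & HdT & _ & Hb).
  exists (mkposreal d Hd). intros T HB HTpos. apply HP.
  unfold ball in *; simpl in *; unfold AbsRing_ball, abs, minus, plus, opp in *; simpl in *.
  rewrite Ropp_0, Rplus_0_r in *. rewrite Rabs_pos_eq in HB by lra.
  destruct (improper_bounded (radial n (decaying_density alpha f u) T) T (eps / (2 * (Rabs A + 1))))
    as (l & Hl & Hl0).
  - apply (decaying_continuous H). lra.
  - intros r Hr. apply (decaying_bounds H T r Hr).
  - lra.
  - apply Hb. lra.
  - unfold int_Sigma. fold A.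
    rewrite (is_RInt_gen_unique (V := R_CompleteNormedModule) _ l Hl).
    rewrite Rabs_mult, (Rabs_pos_eq l) by lra.
    pose proof (Rabs_pos A).
    apply Rle_lt_trans with ((Rabs A + 1) * (eps / (2 * (Rabs A + 1)))).
    + apply Rmult_le_compat; lra.
    + replace ((Rabs A + 1) * (eps / (2 * (Rabs A + 1)))) with (eps / 2) by (field; lra). lra.
Qed.

(** [height_from_energy] with lam small makes the contribution of the radial
    derivative small; for this lam the potential part is small near t = 0. *)
Lemma limit_at_origin : 0 < T0 ->
  filterlim (fun p : R * R => u (fst p) (snd p)) (within (Omega T0) (locally (0, 0))) (locally 0).
Proof.
  intros HT0 P [eps HP]. pose proof (cond_pos eps) as Heps.
  destruct (growth_lower_bound f (wave_df H) (wave_df_cont H)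
    (wave_f0 H) (wave_df0 H) (wave_mono H)) as (c & Hc & Hf).
  set (T1 := Rmin 1 (T0 / 2)).
  assert (HT1 : 0 < T1 /\ T1 <= 1 /\ T1 <= T0 / 2).
  { unfold T1. split; [apply Rmin_pos; lra|]. split; [apply Rmin_l|apply Rmin_r]. }
  clearbody T1. destruct HT1 as (HT1 & HT11 & HT12).
  set (E := @slice_energy n alpha f u T1).
  pose proof (slice_energy_nonneg H T1 ltac:(lra)) as HE. fold E in HE.
  (* |u| < eps exactly when sqrt (1 + u^2) - 1 < k. *)
  set (k := sqrt (1 + eps ^ 2) - 1).
  assert (Hk : 0 < k).
  { unfold k. assert (1 < sqrt (1 + eps ^ 2)); [|lra].
    rewrite <- sqrt_1 at 1. apply sqrt_lt_1_alt. split; [lra|]. pose proof (pow_lt eps 2 Heps). lra. }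
  (* lam (2 E) < c k, which leaves room c k for the potential part; + 1 in case E = 0. *)
  set (lam := c * k / (2 * E + 1)).
  assert (Hck : 0 < c * k) by nra.
  assert (Hlam : 0 < lam) by (apply Rdiv_lt_0_compat; lra).
  assert (Heta : 0 < lam * (c * k) / 2) by nra.
  destruct (decaying_integral_small _ HT0 Heta) as (d & Hd & HdT & Hd1 & Hb).
  assert (Hm : 0 < Rmin d T1) by (apply Rmin_pos; lra).
  pose proof (Rmin_l d T1) as M1. pose proof (Rmin_r d T1) as M2.
  exists (mkposreal _ Hm). intros [t r] [HB _] HO. apply HP.
  unfold ball in HB |- *; simpl in HB |- *.
  unfold AbsRing_ball, abs, minus, plus, opp in HB |- *; simpl in HB |- *.
  rewrite Ropp_0, Rplus_0_r in HB |- *. apply Rabs_def2 in HB.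
  unfold Omega in HO; simpl in HO.
  destruct (Req_dec r 0) as [->|Hr0].
  { rewrite (wave_axis H) by lra. rewrite Rabs_R0. exact Heps. }
  pose proof (height_from_energy H c lam (2 * E) (lam * (c * k) / 2) t Hc Hf Hlam ltac:(lra) ltac:(lra)) as Hs.
  specialize (Hs ltac:(intros a Ha;
     apply Rle_trans with (1 := radial_derivative_truncated_le H t a ltac:(lra) Ha);
     apply Rmult_le_compat_l; [lra | apply (energy_monotone H); lra])).
  assert (Hpot : forall a, 0 < a <= t ->
    RInt (radial n (fun t r => f (u t r) ^ 2 / Rpower r alpha) t) a t <= lam * (c * k) / 2).
  { intros a Ha. apply Rle_trans with (2 := Hb t ltac:(lra) a Ha).
    apply RInt_le; [lra| | |].
    - apply ex_RInt_cont; [lra|]. intros z Hz. apply (potential_continuous H); lra.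
    - apply ex_RInt_cont; [lra|]. intros z Hz. apply (decaying_continuous H); lra.
    - intros z Hz. apply Rmult_le_compat_r; [apply pow_le; lra|]. unfold decaying_density.
      pose proof (sin_term_nonneg (u t z) z ltac:(lra)).
      pose proof (pow2_ge_0 (d_t u t z + d_r u t z)).
      assert (0 <= (1 - z / t) * (d_t u t z - d_r u t z) ^ 2); [|lra].
      apply Rmult_le_pos; [|apply pow2_ge_0].
      assert (z / t <= 1) by (apply Rle_div_l; lra). lra. }
  specialize (Hs Hpot r ltac:(lra)).
  assert (Hlt : sqrt (1 + u t r ^ 2) - 1 < k).
  { apply Rle_lt_trans with (1 := Hs). apply Rlt_div_l; [lra|].
    replace (lam * (c * k) / 2 / lam) with (c * k / 2) by (field; lra).
    assert (lam * (2 * E) <= c * k).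
    { unfold lam. apply Rle_trans with (c * k / (2 * E + 1) * (2 * E + 1)).
      - apply Rmult_le_compat_l; [left; exact Hlam|lra].
      - apply Req_le. field. lra. }
    lra. }
  unfold k in Hlt. apply Rnot_le_lt. intros Hge.
  assert (sqrt (1 + eps ^ 2) <= sqrt (1 + u t r ^ 2)); [|lra].
  apply sqrt_le_1_alt. rewrite <- (pow2_abs (u t r)).
  assert (eps ^ 2 <= Rabs (u t r) ^ 2) by (apply pow_incr; lra). lra.
Qed.

End Conclusion.

Theorem theorem1 (n : nat) (alpha : R) (f : R -> R) (T0 : R) (u : R -> R -> R)
  (hn : (2 <= n)%nat)
  (halpha : Rmax (2 * (INR n - 1)) (INR n + 1) <= alpha)
  (hf : smooth f)
  (hf0 : f 0 = 0)
  (hdf0 : Derive f 0 <> 0)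
  (hfmono : forall w : R, 0 <= f w * Derive f w * w)
  (hfint : is_lim (fun x => RInt (fun v => Rabs (f v)) 0 x) p_infty p_infty)
  (hT0 : 0 < T0)
  (hu : smooth_local_solution n alpha f T0 u)
  (hE : finite_energy n alpha f T0 u) :
  ((forall T : R, 0 < T <= T0 -> integrable_Sigma n (decaying_density alpha f u) T) /\
   filterlim (fun T => int_Sigma n (decaying_density alpha f u) T)
     (at_right 0) (locally 0)) /\
  filterlim (fun p : R * R => u (fst p) (snd p))
    (within (Omega T0) (locally (0, 0))) (locally 0).
Proof.
  destruct hu as ((U & HU & HUO & Hreg) & Heq & Hax).
  assert (W : wave n alpha f T0 u U).
  { split; try assumption.
    - apply Rle_trans with (2 := halpha), Rmax_l.
    - apply Rle_trans with (2 := halpha), Rmax_r.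
    - intros x. apply (hf 1%nat x).
    - intros x. apply (ex_derive_continuous (Derive f)), (hf 2%nat x).
    - apply C2_field_of_ex_diff_n; assumption. }
  split; [split|].
  - apply (decaying_integrable W).
  - apply (int_Sigma_decaying_limit W hT0).
  - apply (limit_at_origin W hT0).
Qed.
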